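(* Fix an integer $r\ge1$ and let $0<c<1$. Let $G$ be an $n$-vertex finite simple graph with edge density $c=2e(G)/n^2$. Then \[ N(P_{2r+1},G)\le \begin{cases} \frac12 S_r(c)\,n^{2r+1}+O(n^{2r}),&0<c\le c_r,\\ \frac12 c^{r+1/2}\,n^{2r+1}+O(n^{2r}),&c_r\le c<1, \end{cases} \] where the implied constants depend only on $r$. The bounds are asymptotically sharp: for $0<c<c_r$ the first order extremal value is attained by quasi-star graph sequences, i.e. $N(P_{2r+1},G_n)=\frac12 S_r(c)n^{2r+1}+o(n^{2r+1})$ for every sequence of $n$-vertex graphs $G_n$ converging to the quasi-star graphon of edge density $c$; for $c_r<c<1$ the first order extremal value is attained by quasi-clique graph sequences, i.e. $N(P_{2r+1},G_n)=\frac12 c^{r+1/2}n^{2r+1}+o(n^{2r+1})$ for every sequence of $n$-vertex graphs $G_n$ converging to the quasi-clique graphon of edge density $c$; and at $c=c_r$ both constructions attain the same first order value.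
   Context: $P_k$ is the path on $k$ vertices; $e(G)$ is the number of edges of $G$; $N(H,G)$ is the number of unlabelled subgraphs of $G$ isomorphic to $H$. For $0\le c\le 1$ put $a=\sqrt{1-c}$, $s=1-a$, and \[ S_r(c)=\sum_{j=0}^{r+1}\binom{2r+2-j}{j}s^{2r+1-j}a^j . \] Let $A_r(w)=\sum_{j=0}^{r+1}\binom{2r+2-j}{j}w^j$ and $E_r(w)=A_r(w)^2-(1+2w)^{2r+1}$. Since $E_r(0)=0$, $E_r(w)/w$ is a polynomial; it has a unique positive zero, denoted $w_r$, and $c_r=\frac{1+2w_r}{(1+w_r)^2}\in(0,1)$. A graphon is a symmetric measurable function $W:[0,1]^2\to[0,1]$, with homomorphism density $t(H,W)=\int_{[0,1]^{V(H)}}\prod_{uv\in E(H)}W(x_u,x_v)\prod_{u\in V(H)}dx_u$. The quasi-clique graphon of edge density $c$ is $A^c_{\mathrm{cl}}(x,y)=\mathbf 1_{\max(x,y)<\sqrt c}$, and the quasi-star graphon of edge density $c$ is $A^c_{\mathrm{st}}(x,y)=\mathbf 1_{\min(x,y)<s}$ with $s=1-\sqrt{1-c}$. A sequence of $n$-vertex graphs $G_n$ converges to a graphon $W$ if $\hom(H,G_n)/n^{|V(H)|}\to t(H,W)$ for every finite graph $H$, where $\hom(H,G)$ is the number of homomorphisms from $H$ to $G$. *)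

(* Defs.v *)
From mathcomp Require Import all_boot all_order all_algebra.
From mathcomp Require Import all_classical all_reals all_analysis.
From mathcomp Require Import measurable_realfun.

Set Implicit Arguments.
Unset Strict Implicit.
Unset Printing Implicit Defensive.

Import Order.TTheory GRing.Theory Num.Theory.
Import numFieldNormedType.Exports.

Local Open Scope ring_scope.

Record sgraph := SGraph {
  vertex :> finType;
  adj : rel vertex;
  adj_sym : symmetric adj;
  adj_irrefl : irreflexive adj }.

Definition edges (G : sgraph) : {set {set G}} :=
  [set [set p.1; p.2] | p : G * G & adj p.1 p.2].

Definition path_adj (k : nat) : rel 'I_k :=
  fun i j => (i.+1 == j :> nat) || (j.+1 == i :> nat).

Lemma path_adj_sym k : symmetric (@path_adj k).
Proof. by move=> i j; rewrite /path_adj orbC. Qed.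

Lemma path_adj_irrefl k : irreflexive (@path_adj k).
Proof. by move=> i; rewrite /path_adj orbb; apply/negbTE; rewrite eqn_leq ltnn. Qed.

Definition path_graph (k : nat) : sgraph :=
  SGraph (@path_adj_sym k) (@path_adj_irrefl k).

(* A subgraph of G is a pair of a vertex set and a set of edges of G whose
   endpoints all lie in the vertex set. *)
Definition is_subgraph (G : sgraph) (S : {set G} * {set {set G}}) : bool :=
  (S.2 \subset edges G) && [forall e in S.2, e \subset S.1].

Definition isomorphic_to (H G : sgraph) (S : {set G} * {set {set G}}) : bool :=
  [exists f : {ffun H -> G},
    [&& injectiveb f,
        S.1 == [set f x | x : H]
      & S.2 == [set [set f x | x in e] | e : {set H} in edges H]]].

Definition subgraph_count (H G : sgraph) : nat :=
  #|[set S : {set G} * {set {set G}} | is_subgraph S && isomorphic_to H S]|.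

Definition hom_count (H G : sgraph) : nat :=
  #|[set f : {ffun H -> G} |
      [forall u, forall v, adj u v ==> adj (f u) (f v)]]|.

Definition edge_density (R : realType) (G : sgraph) : R :=
  2 * #|edges G|%:R / #|G|%:R ^+ 2.

Local Open Scope classical_set_scope.

(* Only the values on [0,1]^2 matter. *)
Record graphon (R : realType) := Graphon {
  graphon_fun :> R -> R -> R;
  graphon_measurable :
    measurable_fun (`[0, 1]%classic `*` `[0, 1]%classic : set (R * R))
      (fun p : R * R => graphon_fun p.1 p.2);
  graphon_sym : forall x y, 0 <= x <= 1 -> 0 <= y <= 1 ->
    graphon_fun x y = graphon_fun y x;
  graphon_itv : forall x y, 0 <= x <= 1 -> 0 <= y <= 1 ->
    0 <= graphon_fun x y <= 1 }.

(* Iterated integral over [0,1] of the coordinates of x listed in s; the other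
   coordinates of x are left unchanged. *)
Fixpoint cube_integral (R : realType) (T : eqType) (s : seq T)
    (f : (T -> R) -> R) (x : T -> R) : R :=
  if s is u :: s' then
    \int[lebesgue_measure]_(t in `[0, 1])
      cube_integral s' f [eta x with u |-> t]
  else f x.

(* The comparison of ranks selects one orientation of each edge; the starting
   point 0 is irrelevant since every coordinate is integrated out. *)
Definition hom_density (R : realType) (H : sgraph) (W : graphon R) : R :=
  cube_integral (enum H)
    (fun x : H -> R =>
       \prod_(p : H * H | adj p.1 p.2 && (enum_rank p.1 < enum_rank p.2)%N)
         W (x p.1) (x p.2))
    (fun=> 0).

Definition converges_to (R : realType) (G : nat -> sgraph) (W : graphon R) :
    Prop :=
  forall H : sgraph,
    (fun n : nat => (hom_count H (G n))%:R / n%:R ^+ #|H| : R) @ \oo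
      --> hom_density H W.

Section quasi_graphons.
Variables (R : realType) (c : R).

Definition quasi_clique_fun (x y : R) : R := (Num.max x y < Num.sqrt c)%R%:R.

Definition quasi_star_fun (x y : R) : R :=
  (Num.min x y < 1 - Num.sqrt (1 - c))%R%:R.

Lemma measurable_quasi_clique :
  measurable_fun (`[0, 1]%classic `*` `[0, 1]%classic : set (R * R))
    (fun p : R * R => quasi_clique_fun p.1 p.2).
Proof.
apply: measurable_funTS; rewrite /quasi_clique_fun.
apply: (measurableT_comp (f := fun b : bool => b%:R : R)) => //.
apply: measurable_fun_ltr => //.
by apply: measurable_maxr; [exact: measurable_fst|exact: measurable_snd].
Qed.

Lemma measurable_quasi_star :
  measurable_fun (`[0, 1]%classic `*` `[0, 1]%classic : set (R * R))
    (fun p : R * R => quasi_star_fun p.1 p.2).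
Proof.
apply: measurable_funTS; rewrite /quasi_star_fun.
apply: (measurableT_comp (f := fun b : bool => b%:R : R)) => //.
apply: measurable_fun_ltr => //.
by apply: measurable_minr; [exact: measurable_fst|exact: measurable_snd].
Qed.

Lemma bool_itv01 (b : bool) : 0 <= (b%:R : R) <= 1.
Proof. by case: b; rewrite ?lexx ?ler01. Qed.

Lemma quasi_clique_sym (x y : R) : 0 <= x <= 1 -> 0 <= y <= 1 ->
  quasi_clique_fun x y = quasi_clique_fun y x.
Proof. by move=> _ _; rewrite /quasi_clique_fun maxC. Qed.

Lemma quasi_star_sym (x y : R) : 0 <= x <= 1 -> 0 <= y <= 1 ->
  quasi_star_fun x y = quasi_star_fun y x.
Proof. by move=> _ _; rewrite /quasi_star_fun minC. Qed.

Definition quasi_clique : graphon R :=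
  Graphon measurable_quasi_clique quasi_clique_sym
    (fun _ _ _ _ => bool_itv01 _).

Definition quasi_star : graphon R :=
  Graphon measurable_quasi_star quasi_star_sym
    (fun _ _ _ _ => bool_itv01 _).

End quasi_graphons.

Section threshold.
Variables (R : realType) (r : nat).

Definition S_val (c : R) : R :=
  let a := Num.sqrt (1 - c) in
  let s := 1 - a in
  \sum_(0 <= j < r.+2)
    'C(2 * r + 2 - j, j)%:R * s ^+ (2 * r + 1 - j) * a ^+ j.

Definition A_poly : {poly R} :=
  \sum_(0 <= j < r.+2) 'C(2 * r + 2 - j, j)%:R *: 'X^j.

Definition E_poly : {poly R} :=
  A_poly ^+ 2 - (1 + 2%:R *: 'X) ^+ (2 * r + 1).

(* E_poly vanishes at 0, so the division by 'X is exact. The quotient has a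
   unique positive zero for r >= 1; xget selects it, the value 0 being used
   only when there is none (r = 0). *)
Definition w_val : R := xget 0 [set w : R | 0 < w /\ root (E_poly %/ 'X) w].

Definition c_val : R := (1 + 2 * w_val) / (1 + w_val) ^+ 2.

End threshold.

(* Main.v *)
Require Import Defs.
From mathcomp Require Import all_boot all_order all_algebra.
From mathcomp Require Import all_classical all_reals all_analysis.
From mathcomp Require Import measurable_realfun ring lra zify.

Set Implicit Arguments.
Unset Strict Implicit.
Unset Printing Implicit Defensive.

Import Order.TTheory GRing.Theory Num.Theory.
Import numFieldNormedType.Exports.

(** The number of copies of the path with 2r + 1 vertices is half the number of
    walks with 2r steps, up to O(n^(2r)) walks that repeat a vertex.  So the
    upper bound is a bound on walks, and it rests on three reductions.

    Compression.  Moving the private neighbours of one vertex over to another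
    one never decreases the number of walks ([walks_shift]).  Hence, for given
    numbers of vertices and edges, some graph with the most walks has nested
    neighbourhoods ([exists_nested]), and its vertices split into a clique U and
    an independent set V ([nested_split]).

    Split graphs.  Add a loop at each vertex of U.  Cutting a walk at its steps
    inside U expresses the number of walks as a polynomial with nonnegative
    coefficients in the numbers q_m of walks with m steps that start in U and
    only use the b edges between U and V, plus the number r_(2r) of such walks
    with 2r steps that start in V.  The numbers q_m are controlled by b and q_2, and r_(2r) by
    b and r_2.  The quantities q_2 and r_2 compete: by [bipartite_cherries],
    |V| q_2 + |U| r_2 <= b (|U| |V| + b).  Convexity then puts the number of
    walks below a chord between two extreme cases, in which V is completely
    joined to a part of U, or U to a part of V ([split_graph_walks_le]).

    Three classes.  Both extreme cases are weighted graphs with three classes of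
    masses d, q, v: dominating vertices, a clique, and independent vertices
    joined to the dominating ones only.  For fixed total mass and edge density
    these form a curve that joins the quasi-clique (d = 0) to the quasi-star
    (q = 0).  Put E = v d/dv - q d/dq.  On the curve, parametrised by v, the
    derivative of a walk polynomial is q E x, where x is the walk polynomial
    with two steps less, and the derivative of E x is a nonnegative combination
    of E (E y), for the walk polynomial y with two further steps less, and of
    partial derivatives of x.  All of these are nonnegative because walk
    polynomials have nonnegative coefficients.  So the number of walks
    first decreases and then increases along the curve, and it is largest at an
    end ([curve_walks_le_max], [model_le_extremal]).

    It remains to compare stars with cliques.  The quotient of their values, as
    a function of the leaf mass w of a star with centre mass 1, has a
    logarithmic derivative with the sign of a polynomial whose leading
    coefficient is its only positive one.  The quotient starts at 1, decreases,
    then increases to infinity; it returns to 1 at w_r, which gives the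
    threshold density ([clique_le_star], [star_le_clique]).

    For sharpness, the path densities of the two step graphons are computed by
    integrating out one vertex after the other ([hom_density_path]). *)

Local Open Scope ring_scope.

(** * Path homomorphisms and walks *)

Section paths.
Variable T : finType.

Lemma sum_ffun_recl n (F : {ffun 'I_n.+1 -> T} -> nat) :
  (\sum_f F f = \sum_x \sum_(g : {ffun 'I_n -> T})
    F [ffun i => oapp g x (unlift ord0 i)])%N.
Proof.
rewrite pair_big_dep /=.
pose cons (p : T * {ffun 'I_n -> T}) : {ffun 'I_n.+1 -> T} :=
  [ffun i => oapp p.2 p.1 (unlift ord0 i)].
pose uncons (f : {ffun 'I_n.+1 -> T}) : T * {ffun 'I_n -> T} :=
  (f ord0, [ffun i => f (lift ord0 i)]).
rewrite (reindex cons) //=; exists uncons => [[x g]|f] _ /=.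
- rewrite /uncons /cons /= ffunE unlift_none /=; congr (_, _).
  by apply/ffunP => i; rewrite !ffunE liftK.
- apply/ffunP => i; rewrite ffunE /=.
  by case: unliftP => [j ->|->] /=; rewrite ?ffunE.
Qed.

Fixpoint walks (A : rel T) (k : nat) (x : T) : nat :=
  if k is k'.+1 then (\sum_(y | A x y) walks A k' y)%N else 1%N.

Variable A : rel T.
Hypothesis symA : symmetric A.

Definition path_hom n (f : {ffun 'I_n -> T}) : bool :=
  [forall u, forall v, path_adj u v ==> A (f u) (f v)].

Lemma path_homP n (f : {ffun 'I_n -> T}) :
  reflect (forall u v : 'I_n, path_adj u v -> A (f u) (f v)) (path_hom f).
Proof.
apply: (iffP forallP) => [h u v|h u]; first by move: (h u) => /forallP/(_ v)/implyP.
by apply/forallP => v; apply/implyP; exact: h.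
Qed.

Lemma path_hom_cons n x (g : {ffun 'I_n.+1 -> T}) :
  path_hom ([ffun i => oapp g x (unlift ord0 i)] : {ffun 'I_n.+2 -> T}) =
  A x (g ord0) && path_hom g.
Proof.
set f := finfun _.
have f0 : f ord0 = x by rewrite ffunE unlift_none.
have fS i : f (lift ord0 i) = g i by rewrite ffunE liftK.
apply/path_homP/andP => [h|[h0 /path_homP h] u v].
  split; first by rewrite -f0 -fS; apply: h.
  by apply/path_homP => u v uv; rewrite -!fS; apply: h; rewrite /path_adj /= /bump !add1n.
case: (unliftP ord0 u) => [u' ->|->]; case: (unliftP ord0 v) => [v' ->|->].
- by rewrite !fS /path_adj /= /bump !add1n !eqSS; apply: h.
- rewrite fS f0 /path_adj /= /bump add1n eqSS /= eq_sym => /eqP u0.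
  by rewrite symA (_ : u' = ord0) //; apply/val_inj.
- rewrite fS f0 /path_adj /= /bump add1n eqSS orbF eq_sym => /eqP v0.
  by rewrite (_ : v' = ord0) //; apply/val_inj.
- by rewrite /path_adj /=.
Qed.

Lemma card_path_hom_from n x :
  (\sum_(f : {ffun 'I_n.+1 -> T}) (path_hom f && (f ord0 == x)))%N = walks A n x.
Proof.
elim: n x => [|n IH] x.
  rewrite sum_ffun_recl (bigD1 x) //= [X in (_ + X)%N]big1 => [|y yx]; last first.
    by apply: big1 => g _; rewrite ffunE unlift_none /= (negbTE yx) andbF.
  rewrite addn0.
  rewrite (eq_bigr (fun=> 1%N)) => [|g _].
    by rewrite sum1_card card_ffun card_ord expn0.
  rewrite ffunE unlift_none eqxx andbT; apply/eqP; rewrite eqb1.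
  by apply/path_homP => u v; rewrite !ord1.
rewrite sum_ffun_recl (bigD1 x) //= [X in (_ + X)%N]big1 => [|y yx]; last first.
  by apply: big1 => g _; rewrite ffunE unlift_none /= (negbTE yx) andbF.
rewrite addn0.
transitivity (\sum_(g : {ffun 'I_n.+1 -> T}) \sum_(y | A x y) (path_hom g && (g ord0 == y)))%N.
  apply: eq_bigr => g _.
  rewrite ffunE unlift_none eqxx andbT path_hom_cons.
  have [Ag|Ag] := boolP (A x (g ord0)).
    rewrite (bigD1 (g ord0))//= eqxx andbT big1 ?addn0// => y /andP[_ /negbTE].
    by rewrite eq_sym => ->; rewrite andbF.
  rewrite big1 // => y Axy; case: eqP => [yE|]; rewrite ?andbF//.
  by rewrite yE Axy in Ag.
by rewrite exchange_big /=; apply: eq_bigr => y _; exact: IH.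
Qed.

Lemma card_path_hom n :
  #|[set f : {ffun 'I_n.+1 -> T} | path_hom f]| = (\sum_x walks A n x)%N.
Proof.
under eq_bigr do rewrite -card_path_hom_from.
rewrite exchange_big /= -sum1_card big_mkcond /=; apply: eq_bigr => f _.
rewrite inE (bigD1 (f ord0)) //= eqxx andbT big1 ?addn0; first by case: path_hom.
by move=> y /negbTE; rewrite eq_sym => ->; rewrite andbF.
Qed.

Lemma card_ffun_collapse n (u v : 'I_n.+1) : u != v ->
  (#|[set f : {ffun 'I_n.+1 -> T} | f u == f v]| <= #|T| ^ n)%N.
Proof.
move=> uv.
pose h (f : {ffun 'I_n.+1 -> T}) : {ffun 'I_n -> T} := [ffun i => f (lift v i)].
have hinj : {in [set f : {ffun 'I_n.+1 -> T} | f u == f v] &, injective h}.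
  move=> f g; rewrite !inE => /eqP fu /eqP gu fg.
  have E i : f (lift v i) = g (lift v i) by move/ffunP/(_ i): fg; rewrite !ffunE.
  apply/ffunP => i; case: (unliftP v i) => [j ->|->]; first exact: E.
  by rewrite -fu -gu; case: (unliftP v u) uv => [j ->|->]; rewrite ?eqxx.
by rewrite -(card_in_imset hinj) (leq_trans (max_card _)) // card_ffun card_ord.
Qed.

(** A homomorphism that is not injective identifies two vertices, and the
    position of one of them is then determined by the others. *)
Lemma card_path_hom_inj n :
  (#|[set f : {ffun 'I_n.+1 -> T} | path_hom f]| <=
   #|[set f : {ffun 'I_n.+1 -> T} | path_hom f && injectiveb f]|
     + n.+1 ^ 2 * #|T| ^ n)%N.
Proof.
pose bad := \bigcup_(p : 'I_n.+1 * 'I_n.+1 | p.1 != p.2)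
  [set f : {ffun 'I_n.+1 -> T} | f p.1 == f p.2].
have sub : [set f : {ffun 'I_n.+1 -> T} | path_hom f] \subset
    [set f : {ffun 'I_n.+1 -> T} | path_hom f && injectiveb f] :|: bad.
  apply/fintype.subsetP => f; rewrite !inE => -> /=.
  have [//|/injectivePn [u [v uv fuv]]] := boolP (injectiveb f).
  by apply/bigcupP; exists (u, v) => //; rewrite inE fuv.
rewrite (leq_trans (subset_leq_card sub)) // (leq_trans (leq_card_setU _ _))//.
rewrite leq_add2l (leq_trans (_ : _ <= \sum_(p : 'I_n.+1 * 'I_n.+1 | p.1 != p.2) #|T| ^ n)%N) //.
  rewrite /bad; elim/big_ind2: _ => [|a b c d h1 h2|p pE]; first by rewrite cards0.
    by rewrite (leq_trans (leq_card_setU _ _)) // leq_add.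
  exact: card_ffun_collapse.
rewrite sum_nat_const leq_mul2r; apply/orP; right.
by rewrite (leq_trans (max_card _)) // card_prod card_ord mulnn.
Qed.

End paths.

(** * Copies of a path and embeddings of a path *)

Section edge_sets.
Variable G : sgraph.

Lemma edgesP (e : {set G}) :
  reflect (exists u v : G, adj u v /\ e = [set u; v]) (e \in edges G).
Proof.
apply: (iffP imsetP) => [[[u v] /= uv ->]|[u [v [uv ->]]]].
  by exists u, v; split => //; rewrite inE in uv.
by exists (u, v) => //; rewrite inE.
Qed.

Lemma set2_eq (T : finType) (u v a b : T) : [set u; v] = [set a; b] ->
  (u = a /\ v = b) \/ (u = b /\ v = a).
Proof.
move=> E.
have : u \in [set a; b] by rewrite -E set21.
have : v \in [set a; b] by rewrite -E set22.
have : a \in [set u; v] by rewrite E set21.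
have : b \in [set u; v] by rewrite E set22.
rewrite !inE => /orP[]/eqP h1 /orP[]/eqP h2 /orP[]/eqP h3 /orP[]/eqP h4; subst; auto.
Qed.

Lemma edges2 (u v : G) : ([set u; v] \in edges G) = adj u v.
Proof.
apply/edgesP/idP => [[a [b [ab /set2_eq[] [-> ->]]]]|uv]; first by [].
  by rewrite adj_sym.
by exists u, v.
Qed.

Lemma handshake : (2 * #|edges G| = \sum_(x : G) \sum_(y : G) adj x y)%N.
Proof.
rewrite pair_big /=.
pose P := [set p : G * G | adj p.1 p.2].
transitivity #|P|; last first.
  rewrite -sum1_card big_mkcond /=; apply: eq_bigr => p _; rewrite inE.
  by case: (adj _ _).
pose h (p : G * G) : {set G} := [set p.1; p.2].
have -> : edges G = h @: P.
  apply/setP => e; apply/edgesP/imsetP => [[u [v [uv ->]]]|[[u v]]].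
    by exists (u, v) => //; rewrite inE.
  by rewrite inE /= => uv ->; exists u, v.
rewrite -sum1_card (partition_big_imset h) /=.
rewrite mulnC -sum_nat_const; apply: eq_bigr => e /imsetP[[u v]].
rewrite inE /= => uv ->; rewrite sum1dep_card.
have -> : [set x | (x \in P) && (h x == h (u, v))] = [set (u, v); (v, u)].
  apply/setP => -[a b]; rewrite !inE /h /=; apply/andP/orP => [[_ /eqP/set2_eq]|].
    by case=> -[-> ->]; [left|right].
  by case=> /eqP[-> ->]; [|rewrite finset.setUC adj_sym]; rewrite uv eqxx.
rewrite cards2 xpair_eqE; case: eqP => // uvE.
by move: uv; rewrite uvE adj_irrefl.
Qed.

End edge_sets.

Section path_copies.
Variable G : sgraph.

(** An injective endomorphism of a path cannot turn back, so it keeps the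
    direction of its first step; having as many values as there are vertices, it
    cannot be shifted either. *)
Lemma path_graph_endo k (phi : 'I_k.+1 -> 'I_k.+1) : injective phi ->
  (forall i j, path_adj i j -> path_adj (phi i) (phi j)) ->
  (forall i, phi i = i) \/ (forall i, phi i = rev_ord i).
Proof.
move=> inj hom.
pose F m : nat := phi (inord m).
have Fb m : (F m <= k)%N by rewrite -ltnS ltn_ord.
have step m : (m < k)%N -> (F m.+1 == (F m).+1) || (F m == (F m.+1).+1).
  move=> mk; have : path_adj (inord m : 'I_k.+1) (inord m.+1).
    by rewrite /path_adj !inordK ?eqxx //; lia.
  by move=> /hom; rewrite /path_adj ![(_.+1 == _)%N]eq_sym.
have ne m : (m.+1 < k)%N -> F m != F m.+2.
  move=> mk; apply/eqP => /val_inj/inj/(congr1 val); rewrite /= !inordK //; lia.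
have phiE i : phi i = F i :> nat by rewrite /F inord_val.
clearbody F.
case: k phi inj hom F Fb step ne phiE => [|k] phi inj hom F Fb step ne phiE.
  by left => i; rewrite [LHS]ord1 [RHS]ord1.
have [/eqP up|/eqP down] := orP (step 0 isT).
- have E m : (m <= k.+1)%N -> F m = (F 0 + m)%N /\ (0 < m -> F m = (F m.-1).+1)%N.
    elim: m => [|[|m] IH] mk; first by rewrite addn0.
      by rewrite up addn1.
    have [E1 /(_ isT) E2] := IH (ltnW mk).
    rewrite /= in E2; move/eqP: (ne m mk) => n1.
    have h : F m.+2 = (F m.+1).+1 by have /orP[/eqP|/eqP] := step m.+1 mk; lia.
    by split=> [|_]; [lia|exact: h].
  left => i; apply/val_inj; rewrite /= phiE.
  have := (E k.+1 (leqnn _)).1; have := (E i (ltn_ord i : (i <= k.+1)%N)).1.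
  by have := Fb k.+1; lia.
- have E m : (m <= k.+1)%N -> (F m + m = F 0)%N /\ (0 < m -> (F m).+1 = F m.-1)%N.
    elim: m => [|[|m] IH] mk; first by rewrite addn0.
      by rewrite down addn1.
    have [E1 /(_ isT) E2] := IH (ltnW mk).
    rewrite /= in E2; move/eqP: (ne m mk) => n1.
    have h : (F m.+2).+1 = F m.+1 by have /orP[/eqP|/eqP] := step m.+1 mk; lia.
    by split=> [|_]; [lia|exact: h].
  right => i; apply/val_inj; rewrite /= phiE.
  have := (E k.+1 (leqnn _)).1; have := (E i (ltn_ord i : (i <= k.+1)%N)).1.
  by have := Fb 0%N; lia.
Qed.

Variable k : nat.
Notation H := (path_graph k.+2).

Let path_injs := [set f : {ffun H -> G} | path_hom (@adj G) (f : {ffun 'I_k.+2 -> G}) && injectiveb f].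

Definition copy (f : {ffun H -> G}) : {set G} * {set {set G}} :=
  ([set f x | x : H], [set [set f x | x in e] | e : {set H} in edges H]).

Lemma copy_edge2 (f : {ffun H -> G}) (u v : H) : injective f ->
  ([set f u; f v] \in (copy f).2) = adj u v.
Proof.
move=> fi; apply/imsetP/idP => [[e /edgesP[a [b [ab ->]]]]|uv].
  rewrite imsetU !imset_set1 => /set2_eq[] [/fi -> /fi ->] //.
  by rewrite adj_sym.
exists [set u; v]; last by rewrite imsetU !imset_set1.
by rewrite edges2.
Qed.

Lemma path_injsP (f : {ffun H -> G}) : reflect ((forall u v : H, adj u v -> adj (f u) (f v)) /\ injective f)
  (f \in path_injs).
Proof.
rewrite inE; apply: (iffP andP) => -[].
  by move=> /path_homP h /injectiveP.
by move=> h fi; split; [apply/path_homP|apply/injectiveP].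
Qed.

Lemma subgraphs_copies :
  [set S : {set G} * {set {set G}} | is_subgraph S && isomorphic_to H S]
  = copy @: path_injs.
Proof.
apply/setP => -[V E]; rewrite inE; apply/andP/imsetP.
  move=> [/andP[/= sE _] /existsP[f /and3P[/injectiveP fi /= /eqP VE /eqP EE]]].
  exists f; last by rewrite VE EE.
  apply/path_injsP; split=> // u v uv; rewrite -edges2.
  apply: (fintype.subsetP sE).
  have := copy_edge2 u v fi; rewrite uv /copy /= -EE => ->.
  by [].
move=> [f /path_injsP[h fi] [-> ->]]; split.
  apply/andP; split.
    apply/fintype.subsetP => e /imsetP[_ /(@edgesP H)[u [v [uv ->]]] ->].
    by rewrite imsetU !imset_set1 edges2; apply: h.
  apply/forallP => e; apply/implyP => /imsetP[e' _ ->].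
  by apply/fintype.subsetP => x /imsetP[y _ ->]; apply: imset_f.
by apply/existsP; exists f; rewrite !eqxx !andbT; apply/injectiveP.
Qed.

(** Embeddings with the same image differ by an automorphism of the path, and
    reversal is the only nontrivial one: each copy is counted twice. *)
Lemma copy_fibre (f : {ffun H -> G}) : f \in path_injs ->
  [set g in path_injs | copy g == copy f] = [set f; [ffun x : H => f (rev_ord (x : 'I_k.+2))]].
Proof.
move=> /path_injsP[hf fi].
have rev_adj (u v : 'I_k.+2) : path_adj u v -> path_adj (rev_ord u) (rev_ord v).
  by have := ltn_ord u; have := ltn_ord v; rewrite /path_adj /=; lia.
apply/setP => g; rewrite inE in_set2; apply/andP/orP => [[]|].
  move=> /path_injsP[hg gi] /eqP cE.
  have /fin_all_exists [phi phiE] : forall x : H, exists y : H, f y = g x.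
    move=> x; have : g x \in (copy g).1 by apply: imset_f.
    by rewrite cE => /imsetP[y _ ->]; exists y.
  have phii : injective phi by move=> x y /(congr1 f); rewrite !phiE => /gi.
  have phih (u v : H) : adj u v -> adj (phi u) (phi v).
    move=> uv; rewrite -(copy_edge2 _ _ fi) !phiE -cE copy_edge2 //.
  have [E|E] := @path_graph_endo k.+1 phi phii phih; [left|right].
    by apply/eqP/ffunP => x; rewrite -phiE E.
  by apply/eqP/ffunP => x; rewrite ffunE -phiE E.
case=> /eqP -> {g}; first by split; [apply/path_injsP|].
split.
  apply/path_injsP; split=> [u v uv|u v]; rewrite !ffunE; first exact/hf/rev_adj.
  by move=> /fi /rev_ord_inj.
rewrite /copy xpair_eqE; apply/andP; split.
  apply/eqP/setP => y; apply/imsetP/imsetP => -[x _ ->].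
    by exists (rev_ord (x : 'I_k.+2)); rewrite ?ffunE.
  by exists (rev_ord (x : 'I_k.+2)); rewrite ?ffunE ?rev_ordK.
apply/eqP/setP => y; apply/imsetP/imsetP => -[_ /edgesP[u [v [uv ->]]] ->];
  rewrite imsetU !imset_set1 ?ffunE.
  exists [set (rev_ord (u : 'I_k.+2) : H); (rev_ord (v : 'I_k.+2) : H)].
    by rewrite edges2; apply: rev_adj.
  by rewrite imsetU !imset_set1.
exists [set (rev_ord (u : 'I_k.+2) : H); (rev_ord (v : 'I_k.+2) : H)].
  by rewrite edges2; apply: rev_adj.
by rewrite imsetU !imset_set1 !ffunE !rev_ordK.
Qed.

Lemma card_path_injs : (#|path_injs| = 2 * subgraph_count H G)%N.
Proof.
rewrite /subgraph_count subgraphs_copies -sum1_card (partition_big_imset copy) /=.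
rewrite mulnC -sum_nat_const; apply: eq_bigr => _ /imsetP[f fI ->].
rewrite sum1dep_card copy_fibre // cards2.
case: eqP => // /ffunP/(_ (ord0 : 'I_k.+2)); rewrite ffunE.
by have /path_injsP[_ fi] := fI => /fi /(congr1 val); rewrite /= subSS subn0.
Qed.

End path_copies.

Lemma hom_count_path (G : sgraph) k :
  hom_count (path_graph k.+1) G = (\sum_(x : G) walks (@adj G) k x)%N.
Proof. by rewrite -(card_path_hom (@adj_sym G)). Qed.

Lemma subgraph_count_path_le (G : sgraph) k :
  (2 * subgraph_count (path_graph k.+2) G <= hom_count (path_graph k.+2) G)%N.
Proof.
rewrite -card_path_injs; apply: subset_leq_card.
by apply/fintype.subsetP => f; rewrite !inE => /andP[].
Qed.

Lemma subgraph_count_path_ge (G : sgraph) k :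
  (hom_count (path_graph k.+2) G <=
   2 * subgraph_count (path_graph k.+2) G + k.+2 ^ 2 * #|G| ^ k.+1)%N.
Proof. by rewrite -card_path_injs; exact: card_path_hom_inj. Qed.

(** * Compression to nested neighbourhoods *)

Section shift.
Variables (T : finType) (A : rel T).
Hypotheses (symA : symmetric A) (irrA : irreflexive A).

(** A neighbour of [x] has [x] as a neighbour, so the condition propagates
    along the walk. *)
Lemma walks_nondecreasing k (x y : T) : A x y -> (walks A k x <= walks A k.+1 x)%N.
Proof.
elim: k x y => [|k IH] x y xy /=.
  by rewrite (bigD1 y) //= leq_addr.
by apply: leq_sum => z xz; apply: (IH z x); rewrite symA.
Qed.

Variables u v : T.
Hypothesis uv : u != v.

Definition outside x := (x != u) && (x != v).
Definition merged x w := if x == u then A u w || A v w else A u w && A v w.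
(** Kelmans compression of [v] into [u].  The adjacency of [u] and [v] is kept,
    so that the number of edges does not change. *)
Definition shift_rel : rel T := fun x y =>
  if outside x then (if outside y then A x y else merged y x)
  else if outside y then merged x y else A x y.
Notation A' := shift_rel.

Lemma shift_sym : symmetric A'.
Proof. by move=> x y; rewrite /shift_rel symA; do 2 case: outside. Qed.

Lemma shift_irrefl : irreflexive A'.
Proof. by move=> x; rewrite /shift_rel; case: outside; rewrite irrA. Qed.

Let outu : outside u = false. Proof. by rewrite /outside eqxx. Qed.
Let outv : outside v = false. Proof. by rewrite /outside eqxx andbF. Qed.
Let vu : (v == u) = false. Proof. by rewrite eq_sym (negbTE uv). Qed.

Lemma sum_split (B : pred T) (h : T -> nat) :
  (\sum_(y | B y) h y = B u * h u + B v * h v + \sum_(y | outside y) B y * h y)%N.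
Proof.
rewrite big_mkcond (bigD1 u) //= (bigD1 v) //= ?vu // addnA.
congr (_ + _ + _)%N; try by [case: B; rewrite ?mul1n].
by apply: eq_bigr => y _; case: B; rewrite ?mul1n.
Qed.

Definition common h := (\sum_(w | outside w) (A u w && A v w) * h w)%N.
Definition only_u h := (\sum_(w | outside w) (A u w && ~~ A v w) * h w)%N.
Definition only_v h := (\sum_(w | outside w) (A v w && ~~ A u w) * h w)%N.

Lemma row_u h : (\sum_(y | A u y) h y = A u v * h v + common h + only_u h)%N.
Proof.
rewrite sum_split irrA mul0n add0n -addnA -big_split /=; congr (_ + _)%N.
by apply: eq_bigr => w _; do 2 case: (A _ w); rewrite /= ?mul1n ?addn0.
Qed.

Lemma row_v h : (\sum_(y | A v y) h y = A u v * h u + common h + only_v h)%N.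
Proof.
rewrite sum_split irrA mul0n addn0 -addnA -big_split /= symA; congr (_ + _)%N.
by apply: eq_bigr => w _; do 2 case: (A _ w); rewrite /= ?mul1n ?addn0.
Qed.

Lemma row_shift_u h :
  (\sum_(y | A' u y) h y = A u v * h v + common h + only_u h + only_v h)%N.
Proof.
rewrite sum_split /shift_rel outu outv irrA mul0n add0n -!addnA -!big_split /=.
congr (_ + _)%N; apply: eq_bigr => w ->; rewrite /merged eqxx.
by do 2 case: (A _ w); rewrite /= ?mul1n ?addn0.
Qed.

Lemma row_shift_v h : (\sum_(y | A' v y) h y = A u v * h u + common h)%N.
Proof.
rewrite sum_split /shift_rel outu outv irrA mul0n addn0 symA; congr (_ + _)%N.
by apply: eq_bigr => w ->; rewrite /merged vu.
Qed.

Lemma row_out w h : outside w -> (\sum_(y | A w y) h y =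
  A u w * h u + A v w * h v + \sum_(y | outside y) A w y * h y)%N.
Proof. by move=> ow; rewrite sum_split [A w u]symA [A w v]symA. Qed.

Lemma row_shift_out w h : outside w -> (\sum_(y | A' w y) h y =
  (A u w || A v w) * h u + (A u w && A v w) * h v + \sum_(y | outside y) A w y * h y)%N.
Proof.
move=> ow; rewrite sum_split /shift_rel ow outu outv /merged eqxx vu.
by congr (_ + _)%N; apply: eq_bigr => y ->.
Qed.

Lemma sum_outside_le (B : pred T) (h h' : T -> nat) :
  (forall w, outside w -> B w -> h w <= h' w)%N ->
  (\sum_(w | outside w) B w * h w <= \sum_(w | outside w) B w * h' w)%N.
Proof.
move=> hh; apply: leq_sum => w ow; case Bw: (B w); rewrite ?mul0n// !mul1n.
exact: hh.
Qed.

(** The four facts have to be carried through the induction together.  When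
    [u] and [v] are adjacent, a step of [u] to [v] ends in a vertex that has lost
    its private neighbours; the last fact bounds this loss by the walks
    through private neighbours, which [u] has gained. *)
Lemma walks_shift k :
  [/\ forall w, outside w -> (walks A k w <= walks A' k w)%N,
      (walks A k u + walks A k v <= walks A' k u + walks A' k v)%N,
      (walks A k u <= walks A' k u)%N /\ (walks A k v <= walks A' k u)%N
    & (walks A k v <= walks A' k v + only_v (walks A k))%N /\
      (walks A k u <= walks A' k v + only_u (walks A k))%N].
Proof.
elim: k => [|k [IHw IHuv [IHu IHv] [IHvv IHuv']]]; first by split=> //; rewrite leq_addr.
have C_le : (common (walks A k) <= common (walks A' k))%N.
  by apply: sum_outside_le => w ow _; apply: IHw.
have U_le : (only_u (walks A k) <= only_u (walks A' k))%N.
  by apply: sum_outside_le => w ow _; apply: IHw.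
have V_le : (only_v (walks A k) <= only_v (walks A' k))%N.
  by apply: sum_outside_le => w ow _; apply: IHw.
have U_mono : (only_u (walks A k) <= only_u (walks A k.+1))%N.
  apply: sum_outside_le => w _ /andP[uw _].
  by apply: (@walks_nondecreasing _ _ u); rewrite symA.
have V_mono : (only_v (walks A k) <= only_v (walks A k.+1))%N.
  apply: sum_outside_le => w _ /andP[vw _].
  by apply: (@walks_nondecreasing _ _ v); rewrite symA.
have [ru rv] := (row_u (walks A k), row_v (walks A k)).
have [ru' rv'] := (row_shift_u (walks A' k), row_shift_v (walks A' k)).
split.
- move=> w ow /=; rewrite row_out // row_shift_out //.
  have : (\sum_(y | outside y) A w y * walks A k y <=
          \sum_(y | outside y) A w y * walks A' k y)%N.
    by apply: sum_outside_le => y oy _; apply: IHw.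
  by case: (A u w); case: (A v w); rewrite /= ?mul1n ?mul0n; lia.
- by rewrite /= ru rv ru' rv'; case: (A u v); lia.
- by rewrite /= ru rv ru'; case: (A u v); lia.
- rewrite [walks A k.+1 v]/= [walks A k.+1 u]/= [walks A' k.+1 v]/= ru rv rv'.
  by case: (A u v); lia.
Qed.

Lemma sum_all_split h : (\sum_x h x = h u + h v + \sum_(x | outside x) h x)%N.
Proof. by rewrite (bigD1 u) //= (bigD1 v) //= ?vu // addnA. Qed.

Lemma sum_walks_shift k : (\sum_x walks A k x <= \sum_x walks A' k x)%N.
Proof.
rewrite !sum_all_split; have [hw huv _ _] := walks_shift k.
by apply: leq_add => //; apply: leq_sum.
Qed.

Definition deg (B : rel T) x := (\sum_y B x y)%N.

Lemma degE B x : deg B x = (\sum_(y | B x y) 1)%N.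
Proof. by rewrite /deg [RHS]big_mkcond; apply: eq_bigr => y _; case: B. Qed.

Lemma deg_shift_out w : outside w -> deg A' w = deg A w.
Proof.
move=> ow; rewrite !degE row_out // row_shift_out //; congr (_ + _)%N.
by case: (A u w); case: (A v w).
Qed.

Lemma sum_deg_shift : (\sum_x deg A' x = \sum_x deg A x)%N.
Proof.
rewrite !sum_all_split (eq_bigr (deg A)) => [|w]; last exact: deg_shift_out.
congr (_ + _)%N; rewrite !degE row_u row_v row_shift_u row_shift_v; lia.
Qed.

(** With p and s private neighbours of [u] and [v], the sum of squared degrees
    grows by 2ps. *)
Lemma sum_deg_sqr_shift w1 w2 :
  outside w1 -> A u w1 -> ~~ A v w1 -> outside w2 -> A v w2 -> ~~ A u w2 ->
  (\sum_x deg A x ^ 2 < \sum_x deg A' x ^ 2)%N.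
Proof.
move=> o1 u1 v1 o2 v2 u2.
rewrite !sum_all_split [X in (_ < _ + X)%N](eq_bigr (fun x => deg A x ^ 2)%N); last first.
  by move=> w ow; rewrite deg_shift_out.
rewrite ltn_add2r !degE row_u row_v row_shift_u row_shift_v.
have U0 : (0 < only_u (fun=> 1%N))%N.
  by rewrite /only_u (bigD1 w1) //= u1 v1.
have V0 : (0 < only_v (fun=> 1%N))%N.
  by rewrite /only_v (bigD1 w2) //= v2 u2.
move: U0 V0; move: (only_u _) (only_v _) (common _) => U V C U0 V0.
by case: (A u v); nia.
Qed.

End shift.

(** These are the threshold graphs. *)
Definition nested (T : finType) (A : rel T) := forall u v w1 w2 : T,
  u != v -> outside u v w1 -> A u w1 -> ~~ A v w1 ->
  outside u v w2 -> A v w2 -> ~~ A u w2 -> False.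

(** The graph is chosen to maximise the number of walks and then the sum of
    squared degrees.  If two vertices were not nested, compressing one into the
    other would increase the second quantity and not decrease the first. *)
Lemma exists_nested (T : finType) (A : rel T) k : symmetric A -> irreflexive A ->
  exists B : rel T, [/\ symmetric B, irreflexive B, nested B,
    (\sum_x deg B x = \sum_x deg A x)%N &
    (\sum_x walks A k x <= \sum_x walks B k x)%N].
Proof.
move=> symA irrA.
pose rel_of (E : {set T * T}) : rel T := fun x y => (x, y) \in E.
pose set_of (B : rel T) : {set T * T} := [set p | B p.1 p.2].
have set_ofK B : rel_of (set_of B) =2 B by move=> x y; rewrite /rel_of inE.
have eq_walks B B' : B =2 B' -> walks B k =1 walks B' k.
  move=> BB'; elim: k => [|j IH] x //=.
  by apply: eq_big => [y|y _]; [exact: BB'|exact: IH].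
have eq_deg (B B' : rel T) : B =2 B' -> deg B =1 deg B'.
  by move=> BB' x; apply: eq_bigr => y _; rewrite BB'.
pose good E := [&& [forall x, forall y, rel_of E x y == rel_of E y x],
  [forall x, ~~ rel_of E x x] & \sum_x deg (rel_of E) x == \sum_x deg A x]%N.
have goodP E : reflect [/\ symmetric (rel_of E), irreflexive (rel_of E) &
    \sum_x deg (rel_of E) x = \sum_x deg A x]%N (good E).
  apply: (iffP and3P) => -[h1 h2 h3]; split.
  - by move=> x y; apply/eqP; move/forallP/(_ x)/forallP: h1.
  - by move=> x; apply/negbTE; move/forallP: h2.
  - exact/eqP.
  - by apply/forallP => x; apply/forallP => y; rewrite h1.
  - by apply/forallP => x; rewrite h2.
  - exact/eqP.
(* The factor bnd exceeds every sum of squared degrees, so that Phi orders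
   lexicographically. *)
pose bnd := (\sum_(x : T) #|T| ^ 2).+1%N.
have sq_lt (B : rel T) : (\sum_x deg B x ^ 2 < bnd)%N.
  rewrite /bnd ltnS; apply: leq_sum => x _; rewrite leq_exp2r //.
  by rewrite degE sum1_card max_card.
pose Phi E := (bnd * (\sum_x walks (rel_of E) k x) + \sum_x deg (rel_of E) x ^ 2)%N.
have good0 : good (set_of A).
  apply/goodP; split=> [x y|x|]; rewrite ?set_ofK //.
  by apply: eq_bigr => x _; apply: eq_deg.
case: (arg_maxnP Phi good0) => E /goodP[symE irrE sumE] maxE.
have bnd_mul a b c d : (c < bnd -> d < bnd -> bnd * a + c <= bnd * b + d -> a <= b)%N.
  move=> hc hd h; rewrite leqNgt; apply/negP => ba.
  have := leq_mul (leqnn bnd) ba; rewrite mulnS; lia.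
exists (rel_of E); split=> //.
  move=> u v w1 w2 uv o1 u1 v1 o2 v2 u2.
  pose B := shift_rel (rel_of E) u v.
  have goodB : good (set_of B).
    apply/goodP; split=> [x y|x|]; rewrite ?set_ofK /B.
    - exact: shift_sym.
    - by rewrite shift_irrefl.
    - rewrite -sumE -(sum_deg_shift symE irrE uv).
      by apply: eq_bigr => x _; apply: eq_deg.
  have /= := maxE _ goodB; rewrite leqNgt => /negP; apply.
  have eW : (\sum_x walks (rel_of (set_of B)) k x = \sum_x walks B k x)%N.
    by apply: eq_bigr => x _; apply: eq_walks.
  have eD : (\sum_x deg (rel_of (set_of B)) x ^ 2 = \sum_x deg B x ^ 2)%N.
    by apply: eq_bigr => x _; rewrite (eq_deg _ _ (set_ofK B)).
  rewrite /Phi eW eD.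
  apply: (@leq_ltn_trans (bnd * (\sum_x walks B k x) + \sum_x deg (rel_of E) x ^ 2)%N).
    by rewrite leq_add2r leq_mul2l (sum_walks_shift symE irrE uv) orbT.
  by rewrite ltn_add2l (sum_deg_sqr_shift symE irrE uv o1 u1 v1 o2 v2 u2).
have /= := maxE _ good0.
have eW : (\sum_x walks (rel_of (set_of A)) k x = \sum_x walks A k x)%N.
  by apply: eq_bigr => x _; apply: eq_walks.
by rewrite /Phi eW; apply: bnd_mul.
Qed.

(** The clique is a largest one.  If x and y outside it were adjacent, each of
    them would miss some vertex of the clique; nestedness yields a vertex missed
    by both, which can be traded for x and y. *)
Lemma nested_split (T : finType) (A : rel T) :
  symmetric A -> irreflexive A -> nested A ->
  exists U : {set T}, (forall x y, x \in U -> y \in U -> x != y -> A x y) /\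
    (forall x y, x \notin U -> y \notin U -> ~~ A x y).
Proof.
move=> symA irrA nestA.
pose clique (U : {set T}) := [forall x in U, forall y in U, (x != y) ==> A x y].
have cliqueP (U : {set T}) : reflect (forall x y, x \in U -> y \in U -> x != y -> A x y) (clique U).
  apply: (iffP forallP) => [h x y xU yU xy|h x].
    by have /implyP/(_ xU)/forallP/(_ y)/implyP/(_ yU)/implyP/(_ xy) := h x.
  apply/implyP => xU; apply/forallP => y; apply/implyP => yU; apply/implyP => xy.
  exact: h.
have c0 : clique finset.set0 by apply/cliqueP => x y; rewrite inE.
case: (arg_maxnP (fun U : {set T} => #|U|) c0) => U /cliqueP cU maxU.
exists U; split=> // x y xU yU; apply/negP => xy.
have xny : x != y by apply/eqP => E; rewrite E irrA in xy.
have nonadj z : z \notin U -> exists2 w, w \in U & ~~ A z w.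
  move=> zU; apply/exists_inP; rewrite -negb_forall_in; apply/negP => /forall_inP h.
  have : clique (z |: U).
    apply/cliqueP => a b; rewrite !in_setU1 => /orP[/eqP->|aU] /orP[/eqP->|bU] ab.
    - by rewrite eqxx in ab.
    - exact: h.
    - by rewrite symA h.
    - exact: cU.
  by move=> /maxU; rewrite cardsU1 zU /= add1n ltnn.
have neU z w : z \notin U -> w \in U -> z != w by move=> zU wU; apply: contraNneq zU => ->.
have neUr z w : z \notin U -> w \in U -> w != z by move=> zU wU; rewrite eq_sym neU.
have no_common w : w \in U -> ~~ A x w -> ~~ A y w -> False.
  move=> wU xw yw.
  (* Both x and y are adjacent to every other vertex of U, so that trading w
     for x and y enlarges the clique. *)
  have all_adj a b z : A a b -> a \notin U -> b \notin U -> ~~ A b w ->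
      z \in U -> z != w -> A a z.
    move=> ab aU bU bw zU zw; apply/negPn/negP => az.
    apply: (nestA w a z b) => //.
    - exact: neUr.
    - by rewrite /outside zw neUr.
    - by apply: cU; rewrite // eq_sym.
    - by rewrite /outside neU //=; apply: contraTneq ab => ->; rewrite irrA.
    - by rewrite symA.
  have : clique (x |: (y |: U :\ w)).
    apply/cliqueP => a b; rewrite !in_setU1 !in_setD1.
    move=> /or3P[/eqP->|/eqP->|/andP[aw aU]] /or3P[/eqP->|/eqP->|/andP[bw bU]] ab.
    - by rewrite eqxx in ab.
    - exact: xy.
    - exact: (all_adj x y).
    - by rewrite symA.
    - by rewrite eqxx in ab.
    - by apply: (all_adj y x) => //; rewrite symA.
    - by rewrite symA; apply: (all_adj x y).
    - by rewrite symA; apply: (all_adj y x) => //; rewrite symA.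
    - exact: cU.
  move=> /maxU; rewrite /= !cardsU1 !in_setU1 !in_setD1 (negbTE xny) (negbTE xU) (negbTE yU) !andbF /=.
  by have := cardsD1 w U; rewrite wU; lia.
have [w wU xw] := nonadj x xU.
have [yw|yw] := boolP (A y w); last exact: (no_common w).
have [w' w'U yw'] := nonadj y yU.
have [xw'|xw'] := boolP (A x w'); last exact: (no_common w').
have ww' : w != w' by apply: contraNneq yw' => <-.
apply: (nestA w w' y x) => //; rewrite /outside ?neU //; by rewrite symA.
Qed.

(** * Walk polynomials of the three-class model *)

Section jets.
Variables (R : realType).

(** The values, at masses (d, q, v), of a polynomial f, of E f and E (E f), and of
    the partial derivatives of f in d and in q, where E is the derivation
    v d/dv - q d/dq.  The operations on jets are those on polynomials. *)
Record jet := Jet { jval : R; jtilt : R; jtilt2 : R; jdom : R; jclq : R }.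

Definition jet_add f g :=
  Jet (jval f + jval g) (jtilt f + jtilt g) (jtilt2 f + jtilt2 g) (jdom f + jdom g) (jclq f + jclq g).
Definition jet_muld d f :=
  Jet (d * jval f) (d * jtilt f) (d * jtilt2 f) (d * jdom f + jval f) (d * jclq f).
Definition jet_mulq q f :=
  Jet (q * jval f) (q * (jtilt f - jval f)) (q * (jtilt2 f - 2 * jtilt f + jval f))
      (q * jdom f) (q * jclq f + jval f).
Definition jet_mulv v f :=
  Jet (v * jval f) (v * (jtilt f + jval f)) (v * (jtilt2 f + 2 * jtilt f + jval f))
      (v * jdom f) (v * jclq f).

(** The jets of the weighted numbers of walks with [k] steps that start at a
    dominating vertex, at a clique vertex and at an independent vertex. *)
Fixpoint jets (d q v : R) (k : nat) : jet * jet * jet :=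
  if k is k'.+1 then
    let: (x, y, z) := jets d q v k' in
    let dx := jet_muld d x in
    let y' := jet_add dx (jet_mulq q y) in
    (jet_add y' (jet_mulv v z), y', dx)
  else let one := Jet 1 0 0 0 0 in (one, one, one).

(** The last condition says that (E + m)^2 f is nonnegative.  It holds for each
    monomial because E multiplies a monomial by a number.  All [m] are needed in
    the induction since multiplication by q or v shifts that number by one. *)
Definition jet_pos f :=
  [/\ 0 <= jval f, 0 <= jdom f, 0 <= jclq f &
      forall m : R, 0 <= jtilt2 f + 2 * m * jtilt f + m ^+ 2 * jval f].

Lemma jet_pos_add f g : jet_pos f -> jet_pos g -> jet_pos (jet_add f g).
Proof.
move=> [? ? ? hf] [? ? ? hg]; split; rewrite /= ?addr_ge0 // => m.
by have := hf m; have := hg m; nra.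
Qed.

Lemma jet_pos_muld d f : 0 <= d -> jet_pos f -> jet_pos (jet_muld d f).
Proof.
move=> d0 [? ? ? hf]; split; rewrite /= ?addr_ge0 ?mulr_ge0 // => m.
rewrite [leRHS](_ : _ = d * (jtilt2 f + 2 * m * jtilt f + m ^+ 2 * jval f)); last by ring.
exact: mulr_ge0.
Qed.

Lemma jet_pos_mulq q f : 0 <= q -> jet_pos f -> jet_pos (jet_mulq q f).
Proof.
move=> q0 [? ? ? hf]; split; rewrite /= ?addr_ge0 ?mulr_ge0 // => m.
rewrite [leRHS](_ : _ = q * (jtilt2 f + 2 * (m - 1) * jtilt f + (m - 1) ^+ 2 * jval f));
  last by ring.
exact: mulr_ge0.
Qed.

Lemma jet_pos_mulv v f : 0 <= v -> jet_pos f -> jet_pos (jet_mulv v f).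
Proof.
move=> v0 [? ? ? hf]; split; rewrite /= ?addr_ge0 ?mulr_ge0 // => m.
rewrite [leRHS](_ : _ = v * (jtilt2 f + 2 * (m + 1) * jtilt f + (m + 1) ^+ 2 * jval f));
  last by ring.
exact: mulr_ge0.
Qed.

Lemma jets_pos d q v k : 0 <= d -> 0 <= q -> 0 <= v ->
  let: (x, y, z) := jets d q v k in [/\ jet_pos x, jet_pos y & jet_pos z].
Proof.
move=> d0 q0 v0; elim: k => [|k] /=.
  suff h : jet_pos (Jet 1 0 0 0 0) by [].
  by split; rewrite //= => m; rewrite mulr0 !add0r mulr1 sqr_ge0.
case: (jets d q v k) => [[x y] z] [hx hy hz].
have hd := jet_pos_muld d0 hx.
have hy' := jet_pos_add hd (jet_pos_mulq q0 hy).
by split => //; apply: jet_pos_add => //; apply: jet_pos_mulv.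
Qed.

Definition dom_jet d q v k := (jets d q v k).1.1.

(** The coefficients are those of the characteristic polynomial of the
    three-class model; the other terms come from applying the derivations to
    these coefficients. *)
Lemma dom_jet_rec d q v k :
  let J n := dom_jet d q v n in
  [/\ jval (J k.+3) = (d + q) * jval (J k.+2) + d * v * jval (J k.+1) - d * q * v * jval (J k),
      jtilt (J k.+3) = (d + q) * jtilt (J k.+2) - q * jval (J k.+2)
        + d * v * (jtilt (J k.+1) + jval (J k.+1)) - d * q * v * jtilt (J k),
      jtilt2 (J k.+3) = d * jtilt2 (J k.+2)
        + q * (jtilt2 (J k.+2) - 2 * jtilt (J k.+2) + jval (J k.+2))
        + d * v * (jtilt2 (J k.+1) + 2 * jtilt (J k.+1) + jval (J k.+1))
        - d * q * v * jtilt2 (J k),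
      jdom (J k.+3) = (d + q) * jdom (J k.+2) + d * v * jdom (J k.+1)
        - d * q * v * jdom (J k)
        + jval (J k.+2) + v * jval (J k.+1) - q * v * jval (J k)
    & jclq (J k.+3) = (d + q) * jclq (J k.+2) + d * v * jclq (J k.+1)
        - d * q * v * jclq (J k) + jval (J k.+2) - d * v * jval (J k)].
Proof.
rewrite /dom_jet /=; case: (jets d q v k) => [[x y] z] /=.
by split; ring.
Qed.

Section curve.
Variables (n A : R).

(** The masses of the dominating class and of the clique, as functions of the
    mass [t] of the independent class, when the total mass is [n] and the mass of
    the non-edges is [A], that is, t^2 + 2 t q = A. *)
Definition dom_mass (t : R) := n - (t + A / t) / 2.
Definition clique_mass (t : R) := (A / t - t) / 2.

Let Xf k := fun t => jval (dom_jet (dom_mass t) (clique_mass t) t k).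
Let Ef k := fun t => jtilt (dom_jet (dom_mass t) (clique_mass t) t k).

Lemma is_derive_congr (f g : R -> R) (t a b : R) :
  is_derive t 1 f a -> f =1 g -> a = b -> is_derive t 1 g b.
Proof. by move=> fa /funext <- <-. Qed.

Let derD (f g : R -> R) (t a b : R) : is_derive t 1 f a -> is_derive t 1 g b ->
  is_derive t 1 (fun x => f x + g x) (a + b).
Proof. exact: is_deriveD. Qed.

Let derB (f g : R -> R) (t a b : R) : is_derive t 1 f a -> is_derive t 1 g b ->
  is_derive t 1 (fun x => f x - g x) (a - b).
Proof. exact: is_deriveB. Qed.

Let derM (f g : R -> R) (t a b : R) : is_derive t 1 f a -> is_derive t 1 g b ->
  is_derive t 1 (fun x => f x * g x) (f t * b + g t * a).
Proof. exact: is_deriveM. Qed.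

Let der_cst (a t : R) : is_derive t 1 (fun=> a) (0 : R).
Proof. exact: is_derive_cst. Qed.

Let der_id (t : R) : is_derive t 1 (fun x => x) (1 : R).
Proof. exact: is_derive_id. Qed.

Let der_inv (t : R) : t != 0 -> is_derive t 1 (fun x : R => x^-1) (- (t ^- 2)).
Proof.
move=> t0; apply: (is_derive_congr (is_deriveV (f := fun x => x) t0 (der_id t))) => //.
by rewrite /GRing.scale /= mulr1.
Qed.

Lemma is_derive_dom_mass (t : R) : t != 0 -> is_derive t 1 dom_mass (clique_mass t / t).
Proof.
move=> t0.
apply: (is_derive_congr (derB (der_cst n t)
  (derM (derD (der_id t) (derM (der_cst A t) (der_inv t0))) (der_cst 2^-1 t)))) => //.
by rewrite /clique_mass; field.
Qed.

Lemma is_derive_clique_mass (t : R) : t != 0 -> is_derive t 1 clique_mass (- (1 + clique_mass t / t)).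
Proof.
move=> t0.
apply: (is_derive_congr (derM (derB (derM (der_cst A t) (der_inv t0)) (der_id t))
  (der_cst 2^-1 t))) => //.
by rewrite /clique_mass; field.
Qed.

Definition dom_jet_deriv k (t : R) : R := if k is k'.+2 then clique_mass t * Ef k' t else 0.

(** Induction along the recurrence.  Its coefficients vary on the curve, and
    the terms that come from their derivatives cancel by the recurrence. *)
Lemma is_derive_dom_jet (t : R) k : t != 0 -> is_derive t 1 (Xf k) (dom_jet_deriv k t).
Proof.
move=> t0.
suff [] : [/\ is_derive t 1 (Xf k) (dom_jet_deriv k t), is_derive t 1 (Xf k.+1) (dom_jet_deriv k.+1 t)
         & is_derive t 1 (Xf k.+2) (dom_jet_deriv k.+2 t)] by [].
have hd := is_derive_dom_mass t0; have hq := is_derive_clique_mass t0; have hv := der_id t.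
elim: k => [|k [h0 h1 h2]].
  split.
  - exact: der_cst.
  - apply: (is_derive_congr (derD (derD hd hq) hv)) => [x|/=]; last by field.
    by rewrite /Xf /dom_jet /=; ring.
  - apply: (is_derive_congr (derD (derM (derD hd hq) (derD hd hq))
      (derM (der_cst 2 t) (derM hd hv)))) => [x|/=].
      by rewrite /Xf /dom_jet /=; ring.
    by rewrite /Ef /=; field.
split=> //.
apply: (is_derive_congr (derB (derD (derM (derD hd hq) h2) (derM (derM hd hv) h1))
  (derM (derM (derM hd hq) hv) h0))) => [x|].
  by rewrite /Xf; have [-> _ _ _ _] := dom_jet_rec (dom_mass x) (clique_mass x) x k.
case: k h0 h1 h2 => [|[|k]] h0 h1 h2 /=.
- by rewrite /Xf /Ef /dom_jet /=; field.
- by rewrite /Xf /Ef /dom_jet /=; field.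
rewrite /Ef /Xf.
have [_ -> _ _ _] := dom_jet_rec (dom_mass t) (clique_mass t) t k.
have [-> _ _ _ _] := dom_jet_rec (dom_mass t) (clique_mass t) t k.+1.
by field.
Qed.

(** Up to the factor t, the derivative along the curve is the vector field
    X = q d/dd + E - t d/dq, and the commutator of X and E is
    q d/dd + 2 t d/dq: this is where the two partial derivatives come from. *)
Definition tilt_deriv k (t : R) : R :=
  let J n := dom_jet (dom_mass t) (clique_mass t) t n in
  (if k is k'.+2 then clique_mass t * jtilt2 (J k') else 0)
    + clique_mass t / t * jdom (J k) + 2 * jclq (J k).

Lemma is_derive_tilt (t : R) k : t != 0 -> is_derive t 1 (Ef k) (tilt_deriv k t).
Proof.
move=> t0.
suff [] : [/\ is_derive t 1 (Ef k) (tilt_deriv k t), is_derive t 1 (Ef k.+1) (tilt_deriv k.+1 t)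
         & is_derive t 1 (Ef k.+2) (tilt_deriv k.+2 t)] by [].
have hd := is_derive_dom_mass t0; have hq := is_derive_clique_mass t0; have hv := der_id t.
elim: k => [|k [h0 h1 h2]].
  split.
  - apply: (is_derive_congr (der_cst 0 t)) => //; rewrite /tilt_deriv /=; ring.
  - apply: (is_derive_congr (derB hv hq)) => [x|/=]; last by rewrite /tilt_deriv /=; field.
    by rewrite /Ef /dom_jet /=; ring.
  - apply: (is_derive_congr (derB (derM (der_cst 2 t) (derM hd hv))
      (derM (der_cst 2 t) (derM hq (derD hd hq))))) => [x|/=].
      by rewrite /Ef /dom_jet /=; ring.
    by rewrite /tilt_deriv /=; field.
split=> //.
have hx0 := is_derive_dom_jet k t0.
have hx1 := is_derive_dom_jet k.+1 t0.
have hx2 := is_derive_dom_jet k.+2 t0.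
apply: (is_derive_congr (derB (derD (derB (derM (derD hd hq) h2) (derM hq hx2))
  (derM (derM hd hv) (derD h1 hx1))) (derM (derM (derM hd hq) hv) h0))) => [x|].
  by rewrite /Xf /Ef; have [_ -> _ _ _] := dom_jet_rec (dom_mass x) (clique_mass x) x k.
rewrite /tilt_deriv; have [_ _ _ -> ->] := dom_jet_rec (dom_mass t) (clique_mass t) t k.
rewrite /Ef /Xf.
case: k h0 h1 h2 hx0 hx1 hx2 => [|[|k]] h0 h1 h2 hx0 hx1 hx2 /=.
- by rewrite /Ef /Xf /dom_jet /=; field.
- by rewrite /Ef /Xf /dom_jet /=; field.
rewrite /Ef /Xf.
have [_ _ -> _ _] := dom_jet_rec (dom_mass t) (clique_mass t) t k.
have [_ -> _ _ _] := dom_jet_rec (dom_mass t) (clique_mass t) t k.+1.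
have [-> _ _ _ _] := dom_jet_rec (dom_mass t) (clique_mass t) t k.+1.
by field.
Qed.

End curve.
End jets.

(** * Walks on the curve of fixed edge density *)

Section monotone.
Local Open Scope classical_set_scope.
Local Open Scope ring_scope.
Variable R : realType.

Lemma is_derive_le (f df : R -> R) (a b : R) : a <= b ->
  (forall x, a <= x <= b -> is_derive x 1 f (df x)) ->
  (forall x, a <= x <= b -> 0 <= df x) -> f a <= f b.
Proof.
move=> ab fdf df0.
have cf : {within `[a, b], continuous f}.
  apply: continuous_in_subspaceT => x; rewrite inE /= in_itv /= => xab.
  apply: differentiable_continuous; apply/derivable1_diffP.
  by have [] := fdf _ xab.
have [x xab fE] : exists2 c, c \in `[a, b] & f b - f a = df c * (b - a).
  apply: MVT_segment => // x; rewrite in_itv /= => /andP[ax xb].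
  by apply: fdf; rewrite !ltW.
by rewrite -subr_ge0 fE mulr_ge0 ?subr_ge0//; apply: df0; rewrite in_itv in xab.
Qed.

Lemma is_derive_lt (f df : R -> R) (a b : R) : a < b ->
  (forall x, a <= x <= b -> is_derive x 1 f (df x)) ->
  (forall x, a < x < b -> 0 < df x) -> f a < f b.
Proof.
move=> ab fdf df0.
have cf : {within `[a, b], continuous f}.
  apply: continuous_in_subspaceT => x; rewrite inE /= in_itv /= => xab.
  apply: differentiable_continuous; apply/derivable1_diffP.
  by have [] := fdf _ xab.
have [x xab fE] : exists2 c, c \in `]a, b[ & f b - f a = df c * (b - a).
  apply: MVT => // x; rewrite in_itv /= => /andP[ax xb].
  by apply: fdf; rewrite !ltW.
by rewrite -subr_gt0 fE mulr_gt0 ?subr_gt0//; apply: df0; rewrite in_itv in xab.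
Qed.

Definition curve_walks (n A : R) k x := jval (dom_jet (dom_mass n A x) (clique_mass A x) x k).

(** The derivative is the clique mass times an increasing function, so it
    changes sign at most once, from minus to plus. *)
Lemma curve_walks_le_max (n A a b : R) k t : 0 < a ->
  (forall x, a <= x <= b -> 0 <= dom_mass n A x /\ 0 <= clique_mass A x) ->
  a <= t <= b ->
  curve_walks n A k.+2 t <= Num.max (curve_walks n A k.+2 a) (curve_walks n A k.+2 b).
Proof.
move=> a0 pos tab; set F := curve_walks n A k.+2; have /andP[a_t tb] := tab.
have gt0 x : a <= x <= b -> 0 < x by move=> /andP[ax _]; exact: lt_le_trans ax.
have dF x : a <= x <= b -> is_derive x 1 F (dom_jet_deriv n A k.+2 x).
  by move=> /gt0 x0; apply: is_derive_dom_jet; rewrite gt_eqF.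
pose Ef x := jtilt (dom_jet (dom_mass n A x) (clique_mass A x) x k).
have dEf x : a <= x <= b -> is_derive x 1 Ef (tilt_deriv n A k x).
  by move=> /gt0 x0; apply: is_derive_tilt; rewrite gt_eqF.
have posJ x m : a <= x <= b -> jet_pos (dom_jet (dom_mass n A x) (clique_mass A x) x m).
  move=> xab; have [d0 q0] := pos _ xab; have x0 := gt0 _ xab.
  have := jets_pos m d0 q0 (ltW x0); rewrite /dom_jet.
  by case: (jets _ _ _ _) => [[? ?] ?] [].
have dE0 x : a <= x <= b -> 0 <= tilt_deriv n A k x.
  move=> xab; have [_ q0] := pos _ xab; have x0 := gt0 _ xab.
  have [_ Jd Jq _] := posJ _ k xab.
  apply: addr_ge0; last exact: mulr_ge0.
  apply: addr_ge0; last by apply: mulr_ge0 => //; apply: divr_ge0 => //; exact: ltW.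
  case: (k) => [|[|k']] //; apply: mulr_ge0 => //.
  by have [_ _ _ /(_ 0)] := posJ _ k' xab; rewrite mulr0 !mul0r expr0n mul0r !addr0.
have Emono x y : a <= x -> x <= y -> y <= b -> Ef x <= Ef y.
  move=> ax xy yb; apply: (is_derive_le xy) => z /andP[xz zy].
    by apply: dEf; rewrite (le_trans ax xz) (le_trans zy yb).
  by apply: dE0; rewrite (le_trans ax xz) (le_trans zy yb).
have [Et0|Et0] := leP 0 (Ef t).
- rewrite le_max; apply/orP; right; apply: (is_derive_le tb) => z /andP[tz zb].
    by apply: dF; rewrite (le_trans a_t tz).
  have zab : a <= z <= b by rewrite (le_trans a_t tz).
  have [_ q0] := pos _ zab.
  by rewrite mulr_ge0 // (le_trans Et0) // Emono.
- rewrite le_max; apply/orP; left.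
  rewrite -[leLHS]opprK -[leRHS]opprK lerN2.
  apply: (is_derive_le (f := - F) (df := - dom_jet_deriv n A k.+2) a_t) => z /andP[az zt].
    have Fz : is_derive z 1 F (dom_jet_deriv n A k.+2 z) by apply: dF; rewrite az (le_trans zt).
    exact: is_deriveN.
  have zab : a <= z <= b by rewrite az (le_trans zt).
  have [_ q0] := pos _ zab.
  rewrite fctE oppr_ge0 mulr_ge0_le0 //.
  by rewrite (le_trans _ (ltW Et0)) // Emono.
Qed.
End monotone.

(** * The ratio between star and clique *)

Section star_polynomial.
Variables (R : realType) (r : nat).
Hypothesis r1 : (0 < r)%N.
Notation n := (2 * r + 1)%N.
Notation A := (A_poly R r).

Lemma coef_A_poly j : A`_j = 'C(2 * r + 2 - j, j)%:R.
Proof.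
clear r1; rewrite /A_poly coef_sum big_mkord.
under eq_bigr do rewrite coefZ coefXn.
have [jr|jr] := ltnP j r.+2.
  rewrite (bigD1 (Ordinal jr)) //= eqxx mulr1 big1 ?addr0// => i.
  by rewrite -val_eqE /= eq_sym => /negbTE ->; rewrite mulr0.
rewrite big1 => [|i _]; first by rewrite bin_small//; lia.
by rewrite (_ : (j == i) = false) ?mulr0//; have := ltn_ord i; lia.
Qed.

Definition slope_coef j : R :=
  j.+1%:R * A`_j.+1 + ((2 * j)%:R - n%:R) * A`_j.

(** The numerator of the derivative of log A(w) - (r + 1/2) log (1 + 2w). *)
Definition slope_poly : {poly R} := (1 + 2%:R *: 'X) * A^`() - n%:R *: A.

Lemma slope_coefE j : slope_poly`_j = slope_coef j.
Proof.
rewrite /slope_poly /slope_coef coefB mulrDl mul1r coefD -scalerAl !coefZ.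
rewrite coefXM coef_deriv -[_ *+ _]mulr_natl.
case: j => [|j] /=; first by rewrite muln0; ring.
by rewrite coef_deriv -[_ *+ _]mulr_natl natrM; ring.
Qed.

Lemma slope_coef_le0 j : (j <= r)%N -> slope_coef j <= 0.
Proof.
move=> jr; rewrite /slope_coef !coef_A_poly.
rewrite (_ : (2 * r + 2 - j.+1 = n - j)%N); last lia.
rewrite -natrM mul_bin_left natrM.
rewrite (_ : (2 * r + 2 - j = (n - j).+1)%N); last lia.
rewrite (_ : ((2 * j)%:R - n%:R : R) = - (n - j - j)%:R); last first.
  by rewrite -opprB -natrB; [congr (- _%:R); lia|lia].
rewrite mulNr subr_le0 ler_wpM2l// ler_nat.
exact: leq_bin2l.
Qed.

Lemma slope_coef1 : slope_coef 1 <= -1.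
Proof.
rewrite /slope_coef !coef_A_poly.
rewrite (_ : (2 * r + 2 - 2 = n - 1)%N); last lia.
rewrite -natrM mul_bin_left natrM bin1.
rewrite (_ : (2 * r + 2 - 1 = n)%N); last lia.
rewrite bin1 -natrM.
have -> : ((2 * 1)%:R - n%:R : R) = - (n - 1 - 1)%:R.
  by rewrite -opprB -natrB; [congr (- _%:R); lia|lia].
rewrite mulNr -natrM lerBlDr addrC lerBrDr natr1 ler_nat.
nia.
Qed.

Lemma slope_coef_lead : slope_coef r.+1 = 1.
Proof.
rewrite /slope_coef !coef_A_poly bin_small; last lia.
rewrite (_ : (2 * r + 2 - r.+1 = r.+1)%N); last lia.
rewrite binn (_ : (2 * r.+1 = n + 1)%N); last lia.
by rewrite natrD; ring.
Qed.

Lemma slope_hornerE w : slope_poly.[w] = \sum_(j < r.+2) slope_coef j * w ^+ j.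
Proof.
rewrite (@horner_coef_wide _ r.+2).
  by apply: eq_bigr => j _; rewrite slope_coefE.
apply/leq_sizeP => j jr; rewrite slope_coefE /slope_coef !coef_A_poly.
by rewrite !bin_small ?mulr0 ?addr0//; lia.
Qed.

Lemma slope_lt0 (w : R) : 0 < w < 1 -> slope_poly.[w] < 0.
Proof.
move=> /andP[w0 w1]; rewrite slope_hornerE big_ord_recr /= slope_coef_lead mul1r.
rewrite (bigD1 (Ordinal (r1 : (1 < r.+1)%N)))//=.
have h : \sum_(i < r.+1 | i != Ordinal (r1 : (1 < r.+1)%N)) slope_coef i * w ^+ i <= 0.
  apply: sumr_le0 => i _; rewrite mulr_le0_ge0 ?exprn_ge0 ?(ltW w0)//.
  by apply: slope_coef_le0; rewrite -ltnS.
have h1 := slope_coef1.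
have h2 : w ^+ r.+1 < w.
  by rewrite exprS gtr_pMr// exprn_ilt1 ?(ltW w0)// -lt0n.
by rewrite expr1; nra.
Qed.

(** Only the leading coefficient of [slope_poly] is positive, so its quotient
    by the leading power is increasing. *)
Lemma slope_gt0 (w w' : R) : 0 < w -> w < w' -> 0 <= slope_poly.[w] -> 0 < slope_poly.[w'].
Proof.
move=> w0 ww' h.
have w'0 : 0 < w' := lt_trans w0 ww'.
suff : slope_poly.[w] * w' ^+ r.+1 < slope_poly.[w'] * w ^+ r.+1.
  move=> /(le_lt_trans (mulr_ge0 h (exprn_ge0 _ (ltW w'0)))).
  by rewrite pmulr_lgt0 // exprn_gt0.
rewrite !slope_hornerE !mulr_suml big_ord_recr [ltRHS]big_ord_recr /= !slope_coef_lead.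
rewrite !mul1r [w' ^+ _ * _]mulrC ltrD2r.
rewrite (bigD1 (Ordinal (r1 : (1 < r.+1)%N)))//=.
rewrite [ltRHS](bigD1 (Ordinal (r1 : (1 < r.+1)%N)))//=.
apply: ltr_leD.
  have h1 := slope_coef1; rewrite -!mulrA ltr_nM2l; last lra.
  rewrite !expr1 !exprS mulrCA ltr_pM2l// ltr_pM2l//.
  by rewrite ltr_pXn2r ?nnegrE ?(ltW w0) ?(ltW w'0).
apply: ler_sum => i _; rewrite -!mulrA.
have ir : (i <= r)%N by rewrite -ltnS.
apply: ler_wnM2l; first exact: slope_coef_le0.
have split_exp (x : R) : x ^+ r.+1 = x ^+ i * x ^+ (r.+1 - i).
  by rewrite -exprD subnKC // leqW.
rewrite !split_exp [leLHS]mulrCA ler_pM2l ?exprn_gt0// ler_pM2l ?exprn_gt0//.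
by apply: lerXn2r; rewrite ?nnegrE ?(ltW w0) ?(ltW w'0) ?(ltW ww').
Qed.

Lemma A_poly_gt0 (w : R) : 0 <= w -> 0 < A.[w].
Proof.
move=> w0; rewrite /A_poly horner_sum big_mkord big_ord_recl /=.
rewrite hornerZ hornerXn expr0 bin0 mulr1 ltr_pwDl ?ltr01//.
by apply: sumr_ge0 => i _; rewrite hornerZ hornerXn mulr_ge0 ?exprn_ge0.
Qed.

Lemma A_poly_ge (w : R) : 0 <= w -> w ^+ r.+1 <= A.[w].
Proof.
move=> w0; rewrite /A_poly horner_sum big_mkord big_ord_recr /=.
rewrite [X in _ + X]hornerZ hornerXn (_ : (2 * r + 2 - r.+1 = r.+1)%N); last lia.
rewrite binn mul1r lerDr.
by apply: sumr_ge0 => i _; rewrite hornerZ hornerXn mulr_ge0 ?exprn_ge0.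
Qed.

(** The square of the quotient of the star value by the clique value at the same
    edge density, [w] being the quotient of leaf mass by centre mass.  The square
    avoids the exponent r + 1/2. *)
Definition ratio (w : R) : R := A.[w] ^+ 2 / (1 + 2 * w) ^+ n.

Lemma is_derive_ratio (w : R) : 0 <= w ->
  is_derive w 1 ratio (2 * A.[w] * slope_poly.[w] / (1 + 2 * w) ^+ n.+1).
Proof.
move=> w0; pose B : {poly R} := (1 + 2%:R *: 'X) ^+ n.
have Bw x : B.[x] = (1 + 2 * x) ^+ n by rewrite /B !hornerE.
have w1 : 1 + 2 * w != 0 by lra.
have B0 : B.[w] != 0 by rewrite Bw expf_neq0.
have dB : B^`().[w] = 2 * n%:R * (1 + 2 * w) ^+ n.-1.
  rewrite /B deriv_exp hornerMn derivD derivZ derivX derivC !hornerE.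
  by rewrite -mulr_natl; ring.
have hV : is_derive w 1 (fun x : R => (B.[x])^-1) (- (B.[w] ^- 2) *: B^`().[w]).
  exact: is_deriveV.
have -> : ratio = horner A * horner A * (fun x => B.[x]^-1).
  by apply/funext => x; rewrite /ratio !fctE Bw expr2.
apply: is_derive_eq.
rewrite /GRing.scale /= !fctE dB Bw /slope_poly !hornerE /=.
by rewrite addn1 /= !exprS; field; rewrite w1 expf_neq0.
Qed.

Lemma ratio0 : ratio 0 = 1.
Proof.
rewrite /ratio mulr0 addr0 expr1n divr1 horner_coef0 coef_A_poly bin0.
by rewrite expr1n.
Qed.

Lemma ratio_decreasing_on (a : R) : 0 < a ->
  (forall x, 0 < x < a -> slope_poly.[x] < 0) -> ratio a < 1.
Proof.
move=> a0 sl; rewrite -ratio0 -ltrN2.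
pose df x := - (2 * A.[x] * slope_poly.[x] / (1 + 2 * x) ^+ n.+1).
apply: (is_derive_lt (f := - ratio) (df := df) a0) => x /andP[x0 xa].
  by apply: is_deriveN; exact: is_derive_ratio.
have B0 : 0 < (1 + 2 * x) ^+ n.+1 by rewrite exprn_gt0//; lra.
have A0 := A_poly_gt0 (ltW x0).
rewrite /df oppr_gt0 pmulr_llt0 ?invr_gt0// pmulr_rlt0 ?mulr_gt0//.
by apply: sl; rewrite x0.
Qed.

Lemma ratio_lt1_near0 (w : R) : 0 < w <= 1 -> ratio w < 1.
Proof.
move=> /andP[w0 w1]; apply: ratio_decreasing_on => // x /andP[x0 xw].
by apply: slope_lt0; rewrite x0 (lt_le_trans xw).
Qed.

(** The ratio equals 1 at 0; to be at least 1 at [w] it must have stopped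
    decreasing before, and from there on [slope_gt0] makes it increase. *)
Lemma ratio_increasing (w w' : R) : 0 < w -> w < w' -> 1 <= ratio w -> ratio w < ratio w'.
Proof.
move=> w0 ww' h.
have [x /andP[x0 xw] hx] : exists2 x, 0 < x < w & 0 <= slope_poly.[x].
  apply: contrapT => /forall2NP H.
  suff : ratio w < 1 by rewrite ltNge h.
  apply: ratio_decreasing_on => // x xw.
  by have [/negP|/negP] := H x; rewrite ?xw// -ltNge.
apply: (is_derive_lt ww' (fun y hy => is_derive_ratio (le_trans (ltW w0) (proj1 (andP hy))))).
move=> y /andP[wy yw'].
have B0 : 0 < (1 + 2 * y) ^+ n.+1 by rewrite exprn_gt0//; lra.
have A0 : 0 < A.[y] by apply: A_poly_gt0; lra.
rewrite !mulr_gt0 ?invr_gt0//.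
by apply: (slope_gt0 x0) => //; lra.
Qed.

Lemma horner_E_poly (w : R) : (E_poly R r).[w] = A.[w] ^+ 2 - (1 + 2 * w) ^+ n.
Proof. by rewrite /E_poly !hornerE. Qed.

Lemma E_poly_ge0 (w : R) : 0 <= w -> (0 <= (E_poly R r).[w]) = (1 <= ratio w).
Proof.
move=> w0; rewrite horner_E_poly subr_ge0 /ratio ler_pdivlMr ?mul1r//.
by rewrite exprn_gt0 //; lra.
Qed.

Lemma E_poly_eq0 (w : R) : 0 <= w -> root (E_poly R r) w = (ratio w == 1).
Proof.
move=> w0; rewrite rootE horner_E_poly subr_eq0 /ratio.
have B0 : (1 + 2 * w) ^+ n != 0 by rewrite expf_neq0//; lra.
apply/eqP/eqP => h; first by rewrite h divff.
by apply: (mulIf (invr_neq0 B0)); rewrite h divff.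
Qed.

Lemma root_E_poly_div (w : R) : 0 < w -> root (E_poly R r %/ 'X) w = root (E_poly R r) w.
Proof.
move=> w0.
have d : 'X %| E_poly R r.
  rewrite -['X]subr0 -polyC0 dvdp_XsubCl E_poly_eq0// ratio0 eqxx//.
by rewrite -[in RHS](divpK d) rootM rootX (gt_eqF w0) orbF.
Qed.

Lemma exists_ratio_eq1 : exists2 w, 0 < w & ratio w = 1.
Proof.
have h3 : (1 : R) <= 3 ^+ n by rewrite exprn_ege1//; lra.
(* For w >= 1 the power (1 + 2w)^n is at most (3w)^n, which is below w^(n+1) as
   soon as w exceeds 3^n. *)
pose M : R := 3 ^+ n + 1.
have low : (E_poly R r).[1] <= 0.
  have : ~~ (1 <= ratio 1) by rewrite -ltNge ratio_lt1_near0 // ltr01 lexx.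
  by rewrite -E_poly_ge0 // -ltNge => /ltW.
have high : 0 <= (E_poly R r).[M].
  have M1 : 1 <= M by rewrite /M; lra.
  have M0 : 0 <= M by lra.
  rewrite horner_E_poly subr_ge0.
  apply: (@le_trans _ _ ((3 * M) ^+ n)).
    by apply: lerXn2r; rewrite ?nnegrE; lra.
  apply: (@le_trans _ _ ((M ^+ r.+1) ^+ 2)).
    rewrite exprMn -exprM (_ : (r.+1 * 2 = n.+1)%N); last lia.
    rewrite exprS; apply: ler_wpM2r; first exact: exprn_ge0.
    by rewrite /M lerDl.
  by apply: lerXn2r; rewrite ?nnegrE ?exprn_ge0 ?(ltW (A_poly_gt0 _)) ?A_poly_ge.
have M1 : 1 <= M by rewrite /M; lra.
have lh : (E_poly R r).[1] <= 0 <= (E_poly R r).[M] by rewrite low high.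
have [w /andP[w1 _] rw] := Num.poly_ivt M1 lh.
have w0 : 0 < w by lra.
by exists w => //; apply/eqP; rewrite -E_poly_eq0 ?ltW.
Qed.

Lemma w_valP : 0 < w_val R r /\ ratio (w_val R r) = 1.
Proof.
rewrite /w_val.
have [w w0 rw] := exists_ratio_eq1.
case: xgetP => [x _ [x0]|/(_ w)].
  by rewrite root_E_poly_div // E_poly_eq0 ?ltW // => /eqP.
by case; split => //; rewrite root_E_poly_div // E_poly_eq0 ?ltW // rw.
Qed.

Lemma ratio_ge1 (w : R) : 0 < w -> (1 <= ratio w) = (w_val R r <= w).
Proof.
move=> w0; have [v0 v1] := w_valP.
have [vw|wv|<-] := ltgtP (w_val R r) w; last by rewrite v1 lexx.
  by rewrite ltW // -v1 ratio_increasing // v1.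
apply/negbTE/negP => h.
by have := ratio_increasing w0 wv h; rewrite v1 ltNge h.
Qed.

Lemma ratio_le1 (w : R) : 0 < w -> (ratio w <= 1) = (w <= w_val R r).
Proof.
move=> w0; have [v0 v1] := w_valP.
have [wv|vw|->] := ltgtP w (w_val R r); last by rewrite v1 lexx.
  by rewrite ltW // ltNge ratio_ge1 // -ltNge.
by apply/negbTE; rewrite -ltNge -v1 ratio_increasing // v1.
Qed.

End star_polynomial.

(** * Walks in the three-class model *)

Section star_walks.
Variable R : realType.
Implicit Types u v t : R.

(** The weighted number of walks with [k] steps that start at a given vertex of a
    clique of mass [u] completely joined to an independent set of mass [v].  That
    vertex is adjacent to all vertices, so this also counts all walks with one
    step less. *)
Definition star u v k := jval (dom_jet u 0 v k).

Lemma starSS u v k : star u v k.+2 = u * star u v k.+1 + u * v * star u v k.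
Proof.
rewrite /star /dom_jet /=; case: (jets u 0 v k) => [[x y] z] /=.
by case: k => [|k]; ring.
Qed.

Lemma star0 u v : star u v 0 = 1. Proof. by []. Qed.
Lemma star1 u v : star u v 1 = u + v.
Proof. by rewrite /star /dom_jet /=; ring. Qed.

Lemma nat2_ind (P : nat -> Prop) :
  P 0 -> P 1 -> (forall k, P k -> P k.+1 -> P k.+2) -> forall k, P k.
Proof.
move=> P0 P1 PS k; suff [] : P k /\ P k.+1 by [].
by elim: k => [|k [? ?]]; split => //; apply: PS.
Qed.

Lemma star_sum u v k :
  star u v k = \sum_(j < k.+1) 'C(k.+1 - j, j)%:R * u ^+ (k - j) * v ^+ j.
Proof.
elim/nat2_ind: k => [||k IH0 IH1].
- by rewrite star0 big_ord1 !expr0 bin0 !mulr1.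
- by rewrite star1 2!big_ord_recr big_ord0 /= bin0 bin1 !subSS !subn0; ring.
rewrite starSS IH0 IH1 !mulr_sumr.
rewrite [RHS]big_ord_recl [X in X + _]big_ord_recl /= !bin0 -addrA.
congr (_ + _); first by rewrite /= !subn0 !exprS; ring.
rewrite [RHS]big_ord_recr /= bin_small ?mul0r ?addr0; last by rewrite /bump/=; lia.
rewrite -big_split /=; apply: eq_bigr => j _; rewrite /bump /= !add1n.
have jk := ltn_ord j.
rewrite (_ : (k.+3 - j.+1 = (k.+1 - j).+1)%N); last lia.
rewrite (_ : (k.+2 - j.+1 = k.+1 - j)%N); last lia.
rewrite binS natrD.
rewrite (_ : (k.+1 - j = (k - j).+1)%N); last lia.
rewrite exprS !exprS.
by rewrite (_ : (k.+1 - j.+1 = k - j)%N); [ring|lia].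
Qed.

Lemma star_ge0 u v k : 0 <= u -> 0 <= v -> 0 <= star u v k.
Proof.
by move=> u0 v0; rewrite star_sum sumr_ge0 // => j _; rewrite !mulr_ge0 ?exprn_ge0.
Qed.

Lemma star_scale t u v k : star (t * u) (t * v) k = t ^+ k * star u v k.
Proof.
elim/nat2_ind: k => [||k IH0 IH1]; rewrite ?star0 ?star1 ?expr0 ?expr1 ?mulr1 ?mulrDr//.
by rewrite !starSS IH0 IH1 !exprS; ring.
Qed.

Lemma star_binomial_odd u v r :
  star u v (2 * r + 1) =
  \sum_(0 <= j < r.+2) 'C(2 * r + 2 - j, j)%:R * u ^+ (2 * r + 1 - j) * v ^+ j.
Proof.
rewrite star_sum -(big_mkord xpredT
  (fun j => 'C((2 * r + 1).+1 - j, j)%:R * u ^+ (2 * r + 1 - j) * v ^+ j)).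
rewrite (@big_cat_nat _ _ _ r.+2) //=; last lia.
rewrite [X in _ + X]big_nat_cond [X in _ + X]big1 ?addr0.
  by apply: eq_bigr => j _; rewrite -addn1 -addnA.
by move=> j /andP[/andP[h _] _]; rewrite bin_small ?mul0r//; lia.
Qed.

Lemma S_val_star r (c : R) :
  S_val r c = star (1 - Num.sqrt (1 - c)) (Num.sqrt (1 - c)) (2 * r + 1).
Proof. by rewrite star_binomial_odd. Qed.

Lemma A_poly_star r w : (A_poly R r).[w] = star 1 w (2 * r + 1).
Proof.
rewrite star_binomial_odd /A_poly horner_sum; apply: eq_bigr => j _.
by rewrite hornerZ hornerXn expr1n mulr1.
Qed.

Lemma star_sqr r u v : 0 < u -> 0 <= v ->
  star u v (2 * r + 1) ^+ 2 = (u ^+ 2 + 2 * u * v) ^+ (2 * r + 1) * ratio r (v / u).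
Proof.
move=> u0 v0; have un0 : u != 0 by rewrite gt_eqF.
have vu0 : 0 <= v / u by rewrite divr_ge0 // ltW.
rewrite -[u in star u](mulr1 u) -[v in star _ v](divfK un0) [_ / u * u]mulrC.
rewrite star_scale -A_poly_star exprMn exprAC /ratio.
rewrite (_ : u ^+ 2 + 2 * u * v = u ^+ 2 * (1 + 2 * (v / u))); last by field.
rewrite [in RHS]exprMn.
have B0 : (1 + 2 * (v / u)) ^+ (2 * r + 1) != 0 by rewrite expf_neq0//; lra.
by rewrite -mulrA; congr (_ * _); rewrite mulrCA divff ?mulr1.
Qed.

Section extremal_bound.
Variable r : nat.
Hypothesis r1 : (0 < r)%N.
Notation n := (2 * r + 1)%N.

Definition extremal_bound (c : R) := Num.max (S_val r c) (Num.sqrt c ^+ n).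

Lemma sqrt_param (c : R) : 0 < c < 1 ->
  let a := Num.sqrt (1 - c) in [/\ 0 < a, a < 1 & c = (1 - a) ^+ 2 + 2 * (1 - a) * a].
Proof.
move=> /andP[c0 c1] a.
have a2 : a ^+ 2 = 1 - c by rewrite sqr_sqrtr //; lra.
have a0 : 0 < a by rewrite sqrtr_gt0; lra.
split => //; last by rewrite -[LHS](subKr 1) -a2; ring.
by rewrite -(@ltr_pXn2r _ 2) ?nnegrE ?(ltW a0)// a2 expr1n; lra.
Qed.

Lemma clique_le_extremal (c e x : R) : 0 < c < 1 -> 0 <= e -> 0 <= x -> x ^+ 2 <= e ^+ n ->
  x <= Num.sqrt (e / c) ^+ n * extremal_bound c.
Proof.
move=> /andP[c0 c1] e0 x0 xe.
apply: (@le_trans _ _ (Num.sqrt (e / c) ^+ n * Num.sqrt c ^+ n)); last first.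
  by apply: ler_wpM2l; rewrite ?exprn_ge0 ?sqrtr_ge0// /extremal_bound le_max lexx orbT.
rewrite -exprMn -sqrtrM ?divr_ge0 ?(ltW c0)// divfK ?gt_eqF//.
rewrite -(@ler_pXn2r _ 2) ?nnegrE ?exprn_ge0 ?sqrtr_ge0//.
by rewrite exprAC sqr_sqrtr.
Qed.

(** The star may leave some of the mass [N] isolated.  When it is better than
    the clique, its ratio is at least 1 and increases with the leaf mass, so that
    the star of the same edge density using all of the mass is better still. *)
Lemma star_le_extremal (u v N c : R) : 0 < u -> 0 <= v -> u + v <= N -> 0 < c < 1 ->
  let e := u ^+ 2 + 2 * u * v in
  c * N ^+ 2 <= e -> star u v n <= Num.sqrt (e / c) ^+ n * extremal_bound c.
Proof.
move=> u0 v0 uvN c01 e ce.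
have e0 : 0 <= e by rewrite /e; nra.
have s0 : 0 <= star u v n by apply: star_ge0 => //; exact: ltW.
have sE := star_sqr r u0 v0; rewrite -/e in sE.
have [le1|/ltW ge1] := leP (ratio r (v / u)) 1.
  by apply: clique_le_extremal => //; rewrite sE ler_piMr ?exprn_ge0.
have [a0 a1 cE] := sqrt_param c01; set a := Num.sqrt (1 - c) in a0 a1 cE.
have /andP[c0 c1] := c01.
have [v_eq0|v_neq0] := eqVneq v 0.
  apply: clique_le_extremal => //; by rewrite sE v_eq0 mul0r ratio0 mulr1.
have w0 : 0 < v / u by rewrite divr_gt0 // lt_neqAle eq_sym v_neq0.
have s_gt0 : 0 < 1 - a by lra.
have ww' : v / u <= a / (1 - a).
  have h : v <= a * (u + v).
    rewrite -(@ler_pXn2r _ 2) ?nnegrE ?mulr_ge0 //; [|lra|lra].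
    rewrite exprMn.
    have : c * (u + v) ^+ 2 <= e by rewrite (le_trans _ ce)// ler_pM2l// ler_sqr ?nnegrE; lra.
    rewrite /e => h.
    have -> : a ^+ 2 = 1 - c by rewrite cE; ring.
    nra.
  by rewrite ler_pdivrMr // mulrAC ler_pdivlMr //; lra.
have rle : ratio r (v / u) <= ratio r (a / (1 - a)).
  have [-> //|neq] := eqVneq (v / u) (a / (1 - a)).
  by apply/ltW/ratio_increasing => //; rewrite lt_neqAle neq.
have SE := star_sqr r s_gt0 (ltW a0); rewrite -cE -S_val_star in SE.
have S0 : 0 <= S_val r c by rewrite S_val_star; apply: star_ge0; apply: ltW.
apply: (@le_trans _ _ (Num.sqrt (e / c) ^+ n * S_val r c)); last first.
  by apply: ler_wpM2l; rewrite ?exprn_ge0 ?sqrtr_ge0// /extremal_bound le_max lexx.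
rewrite -(@ler_pXn2r _ 2) ?nnegrE ?mulr_ge0 ?exprn_ge0 ?sqrtr_ge0//.
rewrite exprMn exprAC sqr_sqrtr ?divr_ge0 ?(ltW c0)//.
rewrite SE sE [leRHS]mulrA -exprMn divfK ?gt_eqF//.
by apply: ler_wpM2l; rewrite ?exprn_ge0.
Qed.

Lemma dom_jet_no_indep (d q : R) k : jval (dom_jet d q 0 k) = (d + q) ^+ k.
Proof.
suff : jval (jets d q 0 k).1.1 = (d + q) ^+ k /\ jval (jets d q 0 k).1.2 = (d + q) ^+ k.
  by case.
elim: k => [|k] /=; first by [].
by case: (jets d q 0 k) => [[x y] z] /= [-> ->]; rewrite exprS; split; ring.
Qed.

Lemma dom_jet_no_dom (q v : R) k : jval (dom_jet 0 q v k.+2) = q ^+ k.+2.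
Proof.
elim: k => [|k IH]; first by rewrite /dom_jet /=; ring.
have [-> _ _ _ _] := dom_jet_rec 0 q v k.
by rewrite IH !exprS; ring.
Qed.

(** The curve through (d, q, v) runs from a clique of edge mass [e] to a star of
    total mass d + q + v. *)
Lemma model_le_extremal (d q v N c : R) : 0 <= d -> 0 <= q -> 0 <= v ->
  d + q + v <= N -> 0 < N -> 0 < c < 1 ->
  let e := (d + q) ^+ 2 + 2 * d * v in
  c * N ^+ 2 <= e -> jval (dom_jet d q v n) <= Num.sqrt (e / c) ^+ n * extremal_bound c.
Proof.
move=> d0 q0 v0 tN N0 c01 e ce.
have /andP[c0 c1] := c01.
have e_gt0 : 0 < e by rewrite (lt_le_trans _ ce) // mulr_gt0 // exprn_gt0.
have [v_eq0|v_neq0] := eqVneq v 0.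
  rewrite v_eq0 dom_jet_no_indep; apply: clique_le_extremal => //.
  - exact: ltW.
  - by rewrite exprn_ge0 // addr_ge0.
  - by rewrite exprAC /e v_eq0 mulr0 addr0.
have v_gt0 : 0 < v by rewrite lt_neqAle eq_sym v_neq0.
pose m := d + q + v; pose A := v ^+ 2 + 2 * q * v.
have A0 : 0 < A by rewrite /A; nra.
have mA : m ^+ 2 = e + A by rewrite /m /e /A; ring.
have m0 : 0 < m by rewrite /m; lra.
pose g := Num.sqrt e; pose b := Num.sqrt A.
have g0 : 0 < g by rewrite sqrtr_gt0.
have b0 : 0 < b by rewrite sqrtr_gt0.
have g2 : g ^+ 2 = e by rewrite sqr_sqrtr // ltW.
have b2 : b ^+ 2 = A by rewrite sqr_sqrtr // ltW.
have gm : g < m by rewrite -(@ltr_pXn2r _ 2) ?nnegrE ?ltW// g2 mA; lra.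
have bm : b < m by rewrite -(@ltr_pXn2r _ 2) ?nnegrE ?ltW// b2 mA; lra.
have AE : A = (m - g) * (m + g) by rewrite -subr_sqr mA g2; ring.
have vb : v <= b by rewrite -(@ler_pXn2r _ 2) ?nnegrE ?(ltW b0)// b2 /A; nra.
have dqg : d + q <= g.
  by rewrite -(@ler_pXn2r _ 2) ?nnegrE ?(ltW g0) ?addr_ge0// g2 /e; nra.
have cdv : dom_mass m A v = d by rewrite /dom_mass /A /m; field.
have cqv : clique_mass A v = q by rewrite /clique_mass /A; field.
have a_gt0 : 0 < m - g by lra.
have an0 : m - g != 0 by rewrite gt_eqF.
have cda : dom_mass m A (m - g) = 0 by rewrite /dom_mass AE; field.
have cqa : clique_mass A (m - g) = g by rewrite /clique_mass AE; field.
have bn0 : b != 0 by rewrite gt_eqF.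
have cdb : dom_mass m A b = m - b by rewrite /dom_mass -b2; field.
have cqb : clique_mass A b = 0 by rewrite /clique_mass -b2; field.
have nE : n = (2 * r - 1).+2 by clear -r1; lia.
have pos x : m - g <= x <= b -> 0 <= dom_mass m A x /\ 0 <= clique_mass A x.
  move=> /andP[ax xb]; have x0 : 0 < x by lra.
  have xn0 : x != 0 by rewrite gt_eqF.
  have -> : dom_mass m A x = (x - (m - g)) * (m + g - x) / (2 * x).
    by rewrite /dom_mass AE; field.
  have -> : clique_mass A x = (b - x) * (b + x) / (2 * x) by rewrite /clique_mass -b2; field.
  by split; rewrite divr_ge0 ?mulr_ge0 //; lra.
have mid : m - g <= v <= b by rewrite vb andbT /m; lra.
have := curve_walks_le_max (2 * r - 1) a_gt0 pos mid.
rewrite /curve_walks -nE cdv cqv cda cqa cdb cqb le_max => /orP[] h.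
- apply: (le_trans h); rewrite nE dom_jet_no_dom -nE.
  apply: clique_le_extremal => //.
  - exact: ltW.
  - by rewrite exprn_ge0 // ltW.
  - by rewrite exprAC g2.
- apply: (le_trans h).
  have eE : e = (m - b) ^+ 2 + 2 * (m - b) * b.
    by rewrite (_ : e = m ^+ 2 - b ^+ 2); [ring|rewrite mA b2; ring].
  have mb0 : 0 < m - b by rewrite subr_gt0.
  have mbN : m - b + b <= N by rewrite subrK.
  have := star_le_extremal mb0 (ltW b0) mbN c01.
  by rewrite -eE; apply.
Qed.

End extremal_bound.
End star_walks.

(** * The threshold density *)

Section threshold_density.
Variables (R : realType) (r : nat).
Hypothesis r0 : (0 < r)%N.
Notation n := (2 * r + 1)%N.
Notation cr := (c_val R r).

Lemma density_of_ratio_lt (w w' : R) : 0 <= w -> w < w' ->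
  (1 + 2 * w') / (1 + w') ^+ 2 < (1 + 2 * w) / (1 + w) ^+ 2.
Proof.
move=> w0 ww'.
have [p p'] : 0 < (1 + w) ^+ 2 /\ 0 < (1 + w') ^+ 2 by split; apply: exprn_gt0; lra.
rewrite ltr_pdivrMr // mulrAC ltr_pdivlMr //.
rewrite -subr_gt0 (_ : _ - _ = (w' - w) * (w + w' + 2 * w * w')); last by ring.
by rewrite mulr_gt0 ?subr_gt0// ltr_wpDr ?mulr_ge0//; lra.
Qed.

Lemma c_val_itv : 0 < cr < 1.
Proof.
have [w0 _] := w_valP R r0; rewrite /c_val.
have p : 0 < (1 + w_val R r) ^+ 2 by rewrite exprn_gt0//; lra.
rewrite divr_gt0 ?ltr_pdivrMr ?mul1r //=; last lra.
by rewrite -subr_gt0 (_ : _ - _ = w_val R r ^+ 2) ?exprn_gt0//; ring.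
Qed.

Lemma sqrt_exp_sqr (c : R) k : 0 <= c -> (Num.sqrt c ^+ k) ^+ 2 = c ^+ k.
Proof. by move=> c0; rewrite exprAC sqr_sqrtr. Qed.

Lemma S_val_ge0 (c : R) : 0 < c < 1 -> 0 <= S_val r c.
Proof.
move=> c01; have [a0 a1 _] := sqrt_param c01.
by rewrite S_val_star star_ge0 // ltW// subr_gt0.
Qed.

Lemma star_param (c : R) : 0 < c < 1 -> exists w : R,
  [/\ 0 < w, c = (1 + 2 * w) / (1 + w) ^+ 2 & S_val r c ^+ 2 = c ^+ n * ratio r w].
Proof.
move=> c01; have [a0 a1 cE] := sqrt_param c01; set a := Num.sqrt (1 - c) in a0 a1 cE.
have s0 : 0 < 1 - a by lra.
have sn0 : 1 - a != 0 by rewrite gt_eqF.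
exists (a / (1 - a)); split; first by rewrite divr_gt0.
  by rewrite {1}cE; field; rewrite sn0 subrK oner_eq0.
by rewrite S_val_star star_sqr -?cE // ltW.
Qed.

Lemma density_of_ratio_le (w w' : R) : 0 <= w -> 0 <= w' ->
  ((1 + 2 * w') / (1 + w') ^+ 2 <= (1 + 2 * w) / (1 + w) ^+ 2) = (w <= w').
Proof.
move=> w0 w'0; have [|h] := leP w w'; last by rewrite leNgt density_of_ratio_lt.
by rewrite le_eqVlt => /orP[/eqP->|h]; [exact: lexx|rewrite ltW // density_of_ratio_lt].
Qed.

Lemma clique_le_star (c : R) : 0 < c < 1 ->
  (Num.sqrt c ^+ n <= S_val r c) = (c <= cr).
Proof.
move=> c01; have /andP[c0 _] := c01.
have [w [w0 cw SE]] := star_param c01; have [v0 _] := w_valP R r0.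
rewrite -(@ler_pXn2r _ 2) ?nnegrE ?exprn_ge0 ?sqrtr_ge0 ?S_val_ge0 //.
rewrite sqrt_exp_sqr ?(ltW c0)// SE ler_pMr ?exprn_gt0// ratio_ge1 //.
by rewrite {1}cw /c_val density_of_ratio_le // ltW.
Qed.

Lemma star_le_clique (c : R) : 0 < c < 1 ->
  (S_val r c <= Num.sqrt c ^+ n) = (cr <= c).
Proof.
move=> c01; have /andP[c0 _] := c01.
have [w [w0 cw SE]] := star_param c01; have [v0 _] := w_valP R r0.
rewrite -(@ler_pXn2r _ 2) ?nnegrE ?exprn_ge0 ?sqrtr_ge0 ?S_val_ge0 //.
rewrite sqrt_exp_sqr ?(ltW c0)// SE ger_pMr ?exprn_gt0// ratio_le1 //.
by rewrite {1}cw /c_val density_of_ratio_le // ltW.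
Qed.

Lemma extremal_bound_star (c : R) : 0 < c < 1 -> c <= cr -> extremal_bound r c = S_val r c.
Proof. by move=> c01; rewrite -clique_le_star // /extremal_bound => /max_idPl. Qed.

Lemma extremal_bound_clique (c : R) : 0 < c < 1 -> cr <= c -> extremal_bound r c = Num.sqrt c ^+ n.
Proof. by move=> c01; rewrite -star_le_clique // /extremal_bound => /max_idPr. Qed.

Lemma extremal_bound_le (c : R) : 0 < c < 1 -> extremal_bound r c <= c.
Proof.
move=> c01; have /andP[c0 c1] := c01.
have [a0 a1 cE] := sqrt_param c01; set a := Num.sqrt (1 - c) in a0 a1 cE.
have nE : n = (2 * r - 1).+2 by clear -r0; lia.
have star_le1 k : star (1 - a) a k <= 1 /\ star (1 - a) a k.+1 <= 1.
  elim: k => [|k [h1 h2]]; first by rewrite star0 star1 subrK.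
  split => //; rewrite starSS.
  apply: (@le_trans _ _ ((1 - a) * 1 + (1 - a) * a * 1)); last by nra.
  by apply: lerD; apply: ler_wpM2l; rewrite ?mulr_ge0 ?subr_ge0 // ltW.
rewrite /extremal_bound ge_max; apply/andP; split.
  rewrite S_val_star -/a nE starSS.
  have [h1 h2] := star_le1 (2 * r - 1)%N.
  apply: (@le_trans _ _ ((1 - a) * 1 + (1 - a) * a * 1)).
    by apply: lerD; apply: ler_wpM2l; rewrite ?mulr_ge0 ?subr_ge0 // ltW.
  by rewrite [leRHS]cE; nra.
rewrite nE -addn2 exprD sqr_sqrtr ?(ltW c0) // ger_pMl // exprn_ile1 ?sqrtr_ge0 //.
by rewrite -(sqrtr1 R) ler_wsqrtr ?(ltW c1).
Qed.

Lemma powR_half_odd (c : R) : 0 <= c -> c `^ (r%:R + 1 / 2) = Num.sqrt c ^+ n.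
Proof.
move=> c0; rewrite -powR12_sqrt // -powR_mulrn ?powR_ge0 // -powRrM; congr (_ `^ _).
by rewrite natrD natrM; field.
Qed.

End threshold_density.

(** * Walks in a clique joined to an independent set *)

Section sums_of_squares.
Variable R : realType.

Lemma sum_sqr_diff (I : finType) (P : pred I) (a : I -> R) :
  \sum_(i | P i) \sum_(j | P j) (a i - a j) ^+ 2 =
  2 * (#|P|%:R * (\sum_(i | P i) a i ^+ 2) - (\sum_(i | P i) a i) ^+ 2).
Proof.
under eq_bigr => i _.
  under eq_bigr => j _ do rewrite sqrrB.
  rewrite big_split /= sumrB sumr_const -mulr_natl.
  rewrite [X in _ - X + _](_ : _ = a i * (2 * \sum_(j | P j) a j)); last first.
    by rewrite 2!mulr_sumr; apply: eq_bigr => j _; rewrite -mulr_natl; ring.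
  over.
rewrite big_split /= sumrB sumr_const -mulr_natl -!mulr_sumr -mulr_suml.
by rewrite expr2; ring.
Qed.

Lemma sqr_sum_le (I : finType) (P : pred I) (a : I -> R) :
  (\sum_(i | P i) a i) ^+ 2 <= #|P|%:R * \sum_(i | P i) a i ^+ 2.
Proof.
have : 0 <= \sum_(i | P i) \sum_(j | P j) (a i - a j) ^+ 2.
  by apply: sumr_ge0 => i _; apply: sumr_ge0 => j _; exact: sqr_ge0.
by rewrite sum_sqr_diff; lra.
Qed.

(** For two rows, Cauchy-Schwarz bounds the square of the difference of their
    sums by the number of columns times the number of entries in which they
    differ.  Summing over all pairs of rows gives the claim. *)
Lemma bipartite_cherries (I J : finType) (P : pred I) (Q : pred J) (B : I -> J -> R) (b : R) :
  (forall i j, B i j ^+ 2 = B i j) ->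
  b = \sum_(i | P i) \sum_(j | Q j) B i j ->
  #|Q|%:R * (\sum_(j | Q j) (\sum_(i | P i) B i j) ^+ 2) +
  #|P|%:R * (\sum_(i | P i) (\sum_(j | Q j) B i j) ^+ 2)
  <= b * (#|P|%:R * #|Q|%:R + b).
Proof.
move=> BB bE.
pose d i := \sum_(j | Q j) B i j.
have : \sum_(i | P i) \sum_(i' | P i') (d i - d i') ^+ 2 <=
    #|Q|%:R * \sum_(j | Q j) \sum_(i | P i) \sum_(i' | P i') (B i j - B i' j) ^+ 2.
  rewrite [X in _ <= _ * X]exchange_big /= mulr_sumr; apply: ler_sum => i _.
  rewrite [X in _ <= _ * X]exchange_big /= mulr_sumr; apply: ler_sum => i' _.
  by rewrite /d -sumrB; exact: sqr_sum_le.
under [X in _ <= _ * X]eq_bigr do rewrite sum_sqr_diff.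
rewrite sum_sqr_diff -bE -mulr_sumr sumrB -mulr_sumr.
rewrite [X in _ <= _ * (2 * (_ * X - _))](_ : _ = b); last first.
  by rewrite exchange_big bE /=; apply: eq_bigr => i _; apply: eq_bigr => j _.
by rewrite /d; lra.
Qed.
End sums_of_squares.

Section split_kernels.
Variable R : realType.

(** The relations between the walk counts of a clique joined to an independent
    set: [q] and [r] count the walks in the bipartite graph between the two parts
    that start in the clique and in the independent set, [s] and [h] the walks in
    the whole graph that start in the clique and anywhere.  A walk is cut at its
    first step inside the clique.  The part before that step ends in the clique,
    and it also starts there exactly when its length is even. *)
Definition split_walks (q r s h : nat -> R) := forall k,
  s k = q k + \sum_(m < k) s (k.-1 - m)%N * (q m *+ ~~ odd m) /\
  h k = q k + r k + \sum_(m < k) s (k.-1 - m)%N * q m.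

Lemma chordM (l m x x0 x1 y y0 y1 : R) : 0 <= l -> 0 <= m -> l + m = 1 ->
  0 <= x -> x <= l * x0 + m * x1 -> 0 <= x0 -> x0 <= x1 ->
  0 <= y -> y <= l * y0 + m * y1 -> 0 <= y0 -> y0 <= y1 ->
  [/\ 0 <= x * y, x * y <= l * (x0 * y0) + m * (x1 * y1), 0 <= x0 * y0 & x0 * y0 <= x1 * y1].
Proof.
move=> l0 m0 lm hx0 hx x00 x01 hy0 hy y00 y01; split; rewrite ?mulr_ge0//.
  apply: (le_trans (ler_pM hx0 hy0 hx hy)).
  have := mulr_ge0 (mulr_ge0 l0 m0) (mulr_ge0 (_ : 0 <= x1 - x0) (_ : 0 <= y1 - y0)).
  rewrite !subr_ge0 => /(_ x01 y01).
  have -> : m = 1 - l by lra.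
  by move=> H; rewrite -subr_ge0; apply: le_trans H _; rewrite le_eqVlt; apply/orP; left; apply/eqP; ring.
by apply: ler_pM.
Qed.

(** [s] and [h] are polynomials with nonnegative coefficients in the values of
    [q], plus a single value of [r].  Products of nonnegative quantities with the
    same order at both ends stay below the chord ([chordM]). *)
Lemma split_walks_chord (l m : R) (q r s h q0 r0 s0 h0 q1 r1 s1 h1 : nat -> R) k :
  0 <= l -> 0 <= m -> l + m = 1 ->
  split_walks q r s h -> split_walks q0 r0 s0 h0 -> split_walks q1 r1 s1 h1 ->
  (forall j, [/\ 0 <= q j, q j <= l * q0 j + m * q1 j, 0 <= q0 j & q0 j <= q1 j]) ->
  r k <= l * r0 k + m * r1 k ->
  h k <= l * h0 k + m * h1 k.
Proof.
move=> l0 m0 lm H H0 H1 hq hr.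
have hs j : [/\ 0 <= s j, s j <= l * s0 j + m * s1 j, 0 <= s0 j & s0 j <= s1 j].
  elim/ltn_ind: j => j IH.
  have [-> _] := H j; have [-> _] := H0 j; have [-> _] := H1 j.
  have [a1 a2 a3 a4] := hq j.
  have hterm (i : 'I_j) : let x := s (j.-1 - i)%N * (q i *+ ~~ odd i) in
     let x0 := s0 (j.-1 - i)%N * (q0 i *+ ~~ odd i) in
     let x1 := s1 (j.-1 - i)%N * (q1 i *+ ~~ odd i) in
     [/\ 0 <= x, x <= l * x0 + m * x1, 0 <= x0 & x0 <= x1].
    have ij : (j.-1 - i < j)%N by have := ltn_ord i; clear; lia.
    have [b1 b2 b3 b4] := IH _ ij; have [c1 c2 c3 c4] := hq i.
    by case: (odd i) => /=; rewrite ?mulr0n ?mulr1n; [rewrite !mulr0 addr0|exact: chordM].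
  split.
  - by rewrite addr_ge0 // sumr_ge0 // => i _; have [] := hterm i.
  - rewrite [leRHS](_ : _ = (l * q0 j + m * q1 j) +
      \sum_(i < j) (l * (s0 (j.-1 - i)%N * (q0 i *+ ~~ odd i))
        + m * (s1 (j.-1 - i)%N * (q1 i *+ ~~ odd i)))); last first.
      by rewrite big_split /= -!mulr_sumr; ring.
    by apply: lerD => //; apply: ler_sum => i _; have [] := hterm i.
  - by rewrite addr_ge0 // sumr_ge0 // => i _; have [] := hterm i.
  - by apply: lerD => //; apply: ler_sum => i _; have [] := hterm i.
have [_ ->] := H k; have [_ ->] := H0 k; have [_ ->] := H1 k.
rewrite [leRHS](_ : _ = (l * q0 k + m * q1 k) + (l * r0 k + m * r1 k) +
    \sum_(i < k) (l * (s0 (k.-1 - i)%N * q0 i) + m * (s1 (k.-1 - i)%N * q1 i))); last first.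
  by rewrite big_split /= -!mulr_sumr; ring.
apply: lerD; first by apply: lerD => //; have [] := hq k.
apply: ler_sum => i _.
have [b1 b2 b3 b4] := hs (k.-1 - i)%N; have [c1 c2 c3 c4] := hq i.
by have [] := chordM l0 m0 lm b1 b2 b3 b4 c1 c2 c3 c4.
Qed.

Variables (T : finType) (mu : T -> R) (U : pred T) (B : T -> T -> R).

Definition kernel_op (K : T -> T -> R) (f : T -> R) : T -> R :=
  fun x => \sum_y mu y * K x y * f y.
Definition total (f : T -> R) := \sum_x mu x * f x.
Definition side (b : bool) : T -> R := fun x => (U x == b)%:R.
Definition split_kernel x y : R := (U x && U y)%:R + B x y.
Definition side_walks b k := iter k (kernel_op B) (side b).
Definition all_walks k := iter k (kernel_op split_kernel) (fun=> 1).

Hypothesis symB : forall x y, B x y = B y x.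
Hypothesis suppB : forall x y, U x = U y -> B x y = 0.

Lemma kernel_opD K f g x : kernel_op K (fun y => f y + g y) x = kernel_op K f x + kernel_op K g x.
Proof. by rewrite /kernel_op -big_split; apply: eq_bigr => y _; rewrite mulrDr. Qed.

Lemma kernel_op_ext K f g : f =1 g -> kernel_op K f =1 kernel_op K g.
Proof. by move=> fg x; apply: eq_bigr => y _; rewrite fg. Qed.

Lemma kernel_op_split f x :
  kernel_op split_kernel f x = (\sum_y mu y * side true y * f y) * side true x + kernel_op B f x.
Proof.
rewrite /kernel_op mulr_suml -big_split; apply: eq_bigr => y _ /=.
by rewrite /split_kernel /side !eqb_id; case: (U x); case: (U y); rewrite /=; ring.
Qed.

Lemma kernel_opM K c f x : kernel_op K (fun y => c * f y) x = c * kernel_op K f x.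
Proof. by rewrite /kernel_op mulr_sumr; apply: eq_bigr => y _; ring. Qed.

Lemma kernel_op_sum K n (f : nat -> T -> R) x :
  kernel_op K (fun y => \sum_(i < n) f i y) x = \sum_(i < n) kernel_op K (f i) x.
Proof.
rewrite /kernel_op; under eq_bigr do rewrite mulr_sumr.
by rewrite exchange_big.
Qed.

Definition clique_total f := \sum_y mu y * side true y * f y.

Lemma all_walks_decomp k x : all_walks k x =
  iter k (kernel_op B) (fun=> 1) x + \sum_(m < k) clique_total (all_walks (k.-1 - m)) * side_walks true m x.
Proof.
elim: k x => [|k IH] x; first by rewrite big_ord0 addr0.
rewrite [LHS](_ : _ = kernel_op split_kernel (all_walks k) x) // kernel_op_split -/(clique_total _).
rewrite (kernel_op_ext _ IH) kernel_opD (@kernel_op_sum _ _ (fun m y => clique_total (all_walks (k.-1 - m)) * side_walks true m y)).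
rewrite big_ord_recl /= subn0 addrCA; congr (_ + (_ + _)).
apply: eq_bigr => i _; rewrite kernel_opM /bump /= add1n.
by congr (clique_total (all_walks _) * _); have := ltn_ord i; clear; lia.
Qed.

Lemma kernel_op_adj f g :
  \sum_x mu x * f x * kernel_op B g x = \sum_x mu x * kernel_op B f x * g x.
Proof.
rewrite /kernel_op; under eq_bigr do rewrite mulr_sumr.
rewrite exchange_big /=; apply: eq_bigr => x _.
rewrite mulr_sumr mulr_suml; apply: eq_bigr => y _.
by rewrite symB; ring.
Qed.

Lemma iter_kernel_op_adj k f g :
  \sum_x mu x * f x * iter k (kernel_op B) g x = \sum_x mu x * iter k (kernel_op B) f x * g x.
Proof.
elim: k f g => [//|k IH] f g.
by rewrite [in LHS]iterSr IH kernel_op_adj -iterS.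
Qed.

Lemma clique_total_walks k : clique_total (iter k (kernel_op B) (fun=> 1)) = total (side_walks true k).
Proof. by rewrite /clique_total iter_kernel_op_adj; apply: eq_bigr => x _; rewrite mulr1. Qed.

Lemma side_walks_supp b k x : U x != b (+) odd k -> side_walks b k x = 0.
Proof.
elim: k x => [|k IH] x; rewrite /= ?addbF.
  by rewrite /side_walks /= /side => /negbTE ->.
move=> h; rewrite /kernel_op big1 // => y _.
have [Uxy|Uxy] := eqVneq (U x) (U y); first by rewrite suppB // mulr0 mul0r.
rewrite IH ?mulr0 //; move: h Uxy.
by case: (U x); case: (U y); case: (b); case: (odd k).
Qed.

Lemma clique_total_side_walks k : clique_total (side_walks true k) = total (side_walks true k) *+ ~~ odd k.
Proof.
rewrite /clique_total /total; case ok: (odd k); rewrite ?mulr0n ?mulr1n.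
  apply: big1 => x _; rewrite /side; case: eqP => Ux; rewrite ?mulr0 ?mul0r//.
  by rewrite side_walks_supp ?mulr0// ok Ux.
apply: eq_bigr => x _; rewrite /side; case: eqP => Ux; rewrite ?mulr1//.
by rewrite side_walks_supp ?mulr0// ok; apply/eqP.
Qed.

Lemma total_walks k : total (iter k (kernel_op B) (fun=> 1)) =
  total (side_walks true k) + total (side_walks false k).
Proof.
rewrite /total -big_split /=; apply: eq_bigr => x _; rewrite -mulrDr; congr (_ * _).
elim: k x => [|k IH] x; first by rewrite /side_walks /= /side; case: (U x); rewrite ?addr0 ?add0r.
by rewrite /side_walks !iterS (kernel_op_ext _ IH) kernel_opD.
Qed.

Lemma split_walks_kernel : split_walks (fun k => total (side_walks true k))
  (fun k => total (side_walks false k)) (fun k => clique_total (all_walks k))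
  (fun k => total (all_walks k)).
Proof.
move=> k; split.
  rewrite -clique_total_walks /clique_total; under eq_bigr do rewrite all_walks_decomp mulrDr mulr_sumr.
  rewrite big_split /= exchange_big /=; congr (_ + _); apply: eq_bigr => m _.
  rewrite -clique_total_side_walks /clique_total mulr_sumr; apply: eq_bigr => x _.
  by ring.
rewrite -total_walks /total; under eq_bigr do rewrite all_walks_decomp mulrDr mulr_sumr.
rewrite big_split /= exchange_big /=; congr (_ + _); apply: eq_bigr => m _.
by rewrite mulr_sumr; apply: eq_bigr => x _; ring.
Qed.

End split_kernels.

(** * The three-class model and split graphs *)

Section class_model.
Variables (R : realType) (d q v : R).

Let mu (i : 'I_3) : R := nth 0 [:: d; q; v] i.
Let U (i : 'I_3) := (i < 2)%N.
Let B (i j : 'I_3) : R := ((i + j == 2)%N && (i != j))%:R.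

Let symB x y : B x y = B y x.
Proof. by rewrite /B addnC [x == y]eq_sym. Qed.

Let suppB x y : U x = U y -> B x y = 0.
Proof.
by case: x => -[|[|[|//]]] ?; case: y => -[|[|[|//]]] ?.
Qed.

Lemma model_all_walks k i : all_walks mu U B k i =
  nth 0 [:: jval (jets d q v k).1.1; jval (jets d q v k).1.2; jval (jets d q v k).2] i.
Proof.
elim: k i => [|k IH] i; first by case: i => -[|[|[|//]]].
rewrite [LHS](_ : _ = kernel_op mu (split_kernel U B) (all_walks mu U B k) i) //.
rewrite (kernel_op_ext _ _ IH) /kernel_op !big_ord_recl big_ord0 /=.
case: (jets d q v k) => [[x y] z].
by case: i => -[|[|[|//]]] ?; rewrite /mu /split_kernel /B /U /=; ring.
Qed.

Definition model_q k := total mu (side_walks mu U B true k).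
Definition model_r k := total mu (side_walks mu U B false k).

Lemma model_split_walks : exists s,
  split_walks model_q model_r s (fun k => jval (dom_jet d q v k.+1)).
Proof.
exists (fun k => clique_total mu U (all_walks mu U B k)) => k.
have [hs hh] := split_walks_kernel mu symB suppB k; split => //.
rewrite -[RHS]hh /total !big_ord_recl big_ord0 !model_all_walks /mu /dom_jet /=.
by case: (jets d q v k) => [[x y] z] /=; ring.
Qed.

Lemma model_qE : [/\ model_q 0 = d + q, model_q 1 = d * v, model_q 2 = d * (d * v) &
  forall k, model_q k.+3 = d * v * model_q k.+1].
Proof.
split; rewrite /model_q /total /side_walks /=.
- by rewrite !big_ord_recl big_ord0 /side /U /mu /=; ring.
- by rewrite /kernel_op !big_ord_recl !big_ord0 /side /U /mu /B /=; ring.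
- by rewrite /kernel_op !big_ord_recl !big_ord0 /side /U /mu /B /=; ring.
move=> k; move: (iter k _ _) => f.
by rewrite /kernel_op !big_ord_recl !big_ord0 /mu /B /=; ring.
Qed.

Lemma model_rE : [/\ model_r 0 = v, model_r 1 = d * v &
  forall k, model_r k.+2 = d * v * model_r k].
Proof.
split; rewrite /model_r /total /side_walks /=.
- by rewrite !big_ord_recl big_ord0 /side /U /mu /=; ring.
- by rewrite /kernel_op !big_ord_recl !big_ord0 /side /U /mu /B /=; ring.
case=> [|k] /=; last move: (iter k _ _) => f.
  by rewrite /kernel_op !big_ord_recl !big_ord0 /side /U /mu /B /=; ring.
by rewrite /kernel_op !big_ord_recl !big_ord0 /mu /B /=; ring.
Qed.

Lemma model_q_ge0 : 0 <= d -> 0 <= q -> 0 <= v -> forall k, 0 <= model_q k.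
Proof.
move=> d0 q0 v0; have [q_0 q_1 q_2 q_S] := model_qE.
have h k : 0 <= model_q k.+1 /\ 0 <= model_q k.+2.
  elim: k => [|k [h1 h2]]; first by rewrite q_1 q_2 !mulr_ge0.
  by split => //; rewrite q_S !mulr_ge0.
by case=> [|k]; [rewrite q_0 addr_ge0|have [] := h k].
Qed.

Lemma model_r_even k : model_r (2 * k) = (d * v) ^+ k * v.
Proof.
have [r0 _ rS] := model_rE.
elim: k => [|k IH]; first by rewrite muln0 r0 expr0 mul1r.
by rewrite mulnS rS IH exprS mulrA.
Qed.

End class_model.

Section split_graphs.
Variables (R : realType) (T : finType) (A : rel T) (U : {set T}).
Hypothesis symA : symmetric A.
Hypothesis indepU : forall x y, x \notin U -> y \notin U -> ~~ A x y.

Let inUb (x : T) := x \in U.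
Let mu (x : T) : R := 1.
Definition cross (x y : T) : R := (A x y && ((x \in U) != (y \in U)))%:R.

Lemma cross_sym x y : cross x y = cross y x.
Proof. by rewrite /cross symA eq_sym. Qed.

Lemma cross_supp x y : inUb x = inUb y -> cross x y = 0.
Proof. by rewrite /cross /inUb => ->; rewrite eqxx andbF. Qed.

Lemma cross_ge0 x y : 0 <= cross x y. Proof. exact: ler0n. Qed.
Lemma cross_le1 x y : cross x y <= 1. Proof. by rewrite /cross; case: (_ && _). Qed.

Notation walk := (all_walks mu inUb cross).
Notation swalk := (side_walks mu inUb cross).
Notation cross_op := (kernel_op mu cross).

(** The split kernel has an additional loop at every vertex of the clique. *)
Lemma walks_le_split k x : (walks A k x)%:R <= walk k x.
Proof.
elim: k x => [|k IH] x //=.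
rewrite /kernel_op natr_sum.
rewrite big_mkcond /=; apply: ler_sum => y _.
have wk0 : 0 <= walk k y by apply: le_trans (IH y).
have sk0 : 0 <= split_kernel inUb cross x y by rewrite /split_kernel addr_ge0 ?cross_ge0.
rewrite /mu mul1r; case: ifP => [Axy|_]; last exact: mulr_ge0.
suff -> : split_kernel inUb cross x y = 1 by rewrite mul1r.
rewrite /split_kernel /cross /inUb Axy /=.
have [xU|xU] := boolP (x \in U); have [yU|yU] := boolP (y \in U); rewrite /= ?addr0 ?add0r//.
by have := indepU xU yU; rewrite Axy.
Qed.

Let u : R := #|U|%:R.
Let v : R := #|[predC U]|%:R.
Definition cross_edges : R := \sum_(x in U) \sum_(y | y \notin U) cross x y.
Notation b := cross_edges.
Notation qs k := (total mu (swalk true k)).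
Notation rs k := (total mu (swalk false k)).

Lemma kernel_op_crossE f x : cross_op f x = \sum_y cross x y * f y.
Proof. by apply: eq_bigr => y _; rewrite /mu mul1r. Qed.

Lemma cross_edges_side s : \sum_x \sum_y cross x y * side R inUb s y = b.
Proof.
have E : \sum_x \sum_y cross x y * side R inUb false y = b.
  rewrite /cross_edges [RHS]big_mkcond; apply: eq_bigr => x _.
  have [xU|xU] := boolP (x \in U).
    rewrite [RHS]big_mkcond; apply: eq_bigr => y _.
    by rewrite /side /inUb; case: (y \in U); rewrite ?mulr0 ?mulr1.
  apply: big1 => y _; rewrite /side /inUb; have [yU|yU] := boolP (y \in U).
    by rewrite mulr0.
  by rewrite cross_supp ?mul0r// /inUb (negbTE xU) (negbTE yU).
case: s => //; rewrite -E exchange_big /=; apply: eq_bigr => x _; apply: eq_bigr => y _.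
rewrite cross_sym; have [xy|xy] := eqVneq (inUb x) (inUb y).
  by rewrite (cross_supp xy) !mul0r.
by congr (_ * _); rewrite /side; move: xy; case: (inUb x); case: (inUb y).
Qed.

Lemma side_walks_ge0 s k x : 0 <= swalk s k x.
Proof.
elim: k x => [|k IH] x; first exact: ler0n.
rewrite [leRHS](_ : _ = cross_op (swalk s k) x) // /kernel_op sumr_ge0 // => y _.
by rewrite /mu mul1r mulr_ge0 ?cross_ge0.
Qed.

(** Forgetting the adjacency required in the first of the last two steps leaves
    the last step free to be any edge between the two parts. *)
Lemma total_side_walksSS s k : total mu (swalk s k.+2) <= b * total mu (swalk s k).
Proof.
rewrite -(cross_edges_side (~~ s (+) odd k)) mulr_suml /total; apply: ler_sum => x _.
rewrite /mu mul1r [leLHS](_ : _ = cross_op (cross_op (swalk s k)) x) // {1}/kernel_op mulr_suml.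
apply: ler_sum => y _; rewrite /mu mul1r -mulrA; apply: ler_wpM2l; first exact: cross_ge0.
rewrite /side; case: eqP => [_|/eqP h].
  rewrite mul1r /kernel_op; apply: ler_sum => z _; rewrite /mu mul1r.
  by apply: ler_wpM2r; [exact: side_walks_ge0|exact: cross_le1].
rewrite mul0r [leLHS](_ : _ = swalk s k.+1 y) // side_walks_supp //; first exact: cross_supp.
by move: h; rewrite /=; case: (inUb y); case: s; case: (odd k).
Qed.

Lemma total_clique_side0 : qs 0 = u.
Proof.
rewrite /total /side_walks /side /= /u -sum1_card natr_sum big_mkcond /=.
by rewrite [RHS]big_mkcond; apply: eq_bigr => x _; rewrite /mu mul1r /inUb; case: (x \in U).
Qed.

Lemma total_clique_side1 : qs 1 = b.
Proof.
rewrite -(cross_edges_side true) /total; apply: eq_bigr => x _.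
by rewrite mul1r [swalk _ 1 x]kernel_op_crossE.
Qed.

Lemma cross_row_out (f : T -> R) x : x \notin U ->
  \sum_y cross x y * f y = \sum_(y in U) cross x y * f y.
Proof.
move=> xU; rewrite [RHS]big_mkcond; apply: eq_bigr => y _.
case: ifPn => // yU; rewrite cross_supp ?mul0r // /inUb (negbTE xU) (negbTE yU) //.
Qed.

Lemma cross_row_in (f : T -> R) x : x \in U ->
  \sum_y cross x y * f y = \sum_(y | y \notin U) cross x y * f y.
Proof.
move=> xU; rewrite [RHS]big_mkcond; apply: eq_bigr => y _.
by case: ifPn => // /negPn yU; rewrite cross_supp ?mul0r // /inUb xU yU.
Qed.

Lemma total_clique_side2 : qs 2 = \sum_(y | y \notin U) (\sum_(x in U) cross x y) ^+ 2.
Proof.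
rewrite /total [LHS](_ : _ = \sum_x mu x * 1 * cross_op (swalk true 1) x); last first.
  by apply: eq_bigr => x _; rewrite mulr1.
rewrite kernel_op_adj; last exact: cross_sym.
rewrite [RHS]big_mkcond; apply: eq_bigr => y _.
rewrite mul1r [swalk _ 1 y]kernel_op_crossE kernel_op_crossE.
case: ifPn => [yU|/negPn yU].
  rewrite !cross_row_out // expr2; congr (_ * _); apply: eq_bigr => x xU.
    by rewrite mulr1 cross_sym.
  by rewrite /side /inUb xU mulr1 cross_sym.
rewrite [X in _ * X]big1 ?mulr0 // => x _; rewrite /side /inUb.
by have [xU|xU] := boolP (x \in U); rewrite ?mulr0 // cross_supp ?mul0r// /inUb yU xU.
Qed.

Lemma total_indep_side2 : rs 2 = \sum_(x in U) (\sum_(y | y \notin U) cross x y) ^+ 2.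
Proof.
rewrite /total [LHS](_ : _ = \sum_x mu x * 1 * cross_op (swalk false 1) x); last first.
  by apply: eq_bigr => x _; rewrite mulr1.
rewrite kernel_op_adj; last exact: cross_sym.
rewrite [RHS]big_mkcond; apply: eq_bigr => y _.
rewrite mul1r [swalk _ 1 y]kernel_op_crossE kernel_op_crossE.
case: ifPn => [yU|yU].
  rewrite !cross_row_in // expr2; congr (_ * _); apply: eq_bigr => x xU.
    by rewrite mulr1.
  by rewrite /side /inUb (negbTE xU) mulr1.
rewrite [X in _ * X]big1 ?mulr0 // => x _; rewrite /side /inUb.
by have [xU|xU] := boolP (x \in U); rewrite ?mulr0 // cross_supp ?mul0r// /inUb (negbTE yU) (negbTE xU).
Qed.

(** The second inequality is Cauchy-Schwarz for the degrees in the independent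
    set. *)
Lemma cross_bounds : v * qs 2 + u * rs 2 <= b * (u * v + b) /\ b ^+ 2 <= v * qs 2.
Proof.
rewrite total_clique_side2 total_indep_side2; split.
  apply: (@bipartite_cherries _ _ _ (mem U) [pred y | y \notin U] cross b) => //.
  by move=> x y; rewrite /cross -natrX; case: (_ && _).
rewrite /cross_edges exchange_big /=.
exact: (@sqr_sum_le _ _ [pred y | y \notin U]).
Qed.

End split_graphs.

(** * The number of walks in a split graph *)

Section split_graph_bound.
Variables (R : realType) (T : finType) (A : rel T) (U : {set T}).
Hypothesis symA : symmetric A.
Hypothesis indepU : forall x y, x \notin U -> y \notin U -> ~~ A x y.

Let inUb (x : T) := x \in U.
Let mu (x : T) : R := 1.
Notation cross := (@cross R T A U).
Notation b := (@cross_edges R T A U).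
Notation qs k := (total mu (side_walks mu inUb cross true k)).
Notation rs k := (total mu (side_walks mu inUb cross false k)).
Notation hs k := (total mu (all_walks mu inUb cross k)).
Let u : R := #|U|%:R.
Let v : R := #|[predC U]|%:R.

Lemma cross_edges_ge0 : 0 <= b.
Proof. by apply: sumr_ge0 => x _; apply: sumr_ge0 => y _; exact: cross_ge0. Qed.

Lemma total_side_ge0 s k : 0 <= total mu (side_walks mu inUb cross s k).
Proof. by apply: sumr_ge0 => x _; rewrite mul1r side_walks_ge0. Qed.

(** Every two further steps multiply the bipartite walk counts by at most the
    number of cross edges, and by exactly that much in the models, so that a
    comparison of the counts with two steps is enough. *)
Lemma split_walks_le_models (l m d0 q0 v0 d1 q1 v1 : R) r : (0 < r)%N ->
  0 <= l -> 0 <= m -> l + m = 1 ->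
  [/\ 0 <= d0, 0 <= q0, 0 <= v0, d0 + q0 = u & d0 * v0 = b] ->
  [/\ 0 <= d1, 0 <= q1, 0 <= v1, d1 + q1 = u & d1 * v1 = b] ->
  d0 <= d1 -> qs 2 <= b * (l * d0 + m * d1) -> rs 2 <= b * (l * v0 + m * v1) ->
  hs (2 * r) <= l * jval (dom_jet d0 q0 v0 (2 * r + 1)) + m * jval (dom_jet d1 q1 v1 (2 * r + 1)).
Proof.
move=> r0 l0 m0 lm [d00 q00 v00 u0 b0] [d10 q10 v10 u1 b1] d01 q2 r2.
have bge0 := cross_edges_ge0.
have [s0 H0] := model_split_walks d0 q0 v0.
have [s1 H1] := model_split_walks d1 q1 v1.
have H := split_walks_kernel mu (cross_sym R U symA) (@cross_supp R T A U).
rewrite !addn1.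
apply: (split_walks_chord l0 m0 lm H H0 H1).
- have [qa0 qa1 qa2 qaS] := model_qE d0 q0 v0.
  have [qb0 qb1 qb2 qbS] := model_qE d1 q1 v1.
  have hge k : 0 <= model_q d0 q0 v0 k by apply: model_q_ge0.
  have hS k : [/\ qs k.+1 <= l * model_q d0 q0 v0 k.+1 + m * model_q d1 q1 v1 k.+1,
      model_q d0 q0 v0 k.+1 <= model_q d1 q1 v1 k.+1,
      qs k.+2 <= l * model_q d0 q0 v0 k.+2 + m * model_q d1 q1 v1 k.+2 &
      model_q d0 q0 v0 k.+2 <= model_q d1 q1 v1 k.+2].
    elim: k => [|k [h1 h2 h3 h4]].
      rewrite total_clique_side1 // qa1 qb1 qa2 qb2 b0 b1; split; rewrite ?lexx //.
      + by rewrite -mulrDl lm mul1r.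
      + by apply: (le_trans q2); rewrite le_eqVlt; apply/orP; left; apply/eqP; ring.
      + exact: ler_wpM2r.
    split=> //; rewrite qaS qbS b0 b1; last exact: ler_wpM2l.
    apply: (le_trans (total_side_walksSS R U symA _ _)).
    rewrite [leRHS](_ : _ = b * (l * model_q d0 q0 v0 k.+1 + m * model_q d1 q1 v1 k.+1)); last by ring.
    exact: ler_wpM2l.
  case=> [|k]; last by have [h1 h2 _ _] := hS k; split => //; exact: total_side_ge0.
  rewrite total_clique_side0 qa0 qb0 u0 u1; split; rewrite ?ler0n ?lexx //.
  by rewrite -mulrDl lm mul1r.
- have rk k : rs (2 * k.+1) <= b ^+ k * rs 2.
    elim: k => [|k IH]; first by rewrite muln1 expr0 mul1r.
    rewrite mulnS; apply: (le_trans (total_side_walksSS R U symA _ _)).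
    by rewrite exprS -mulrA; apply: ler_wpM2l.
  rewrite !model_r_even b0 b1; case: r r0 => // r _.
  apply: (le_trans (rk r)).
  rewrite [leRHS](_ : _ = b ^+ r * (b * (l * v0 + m * v1))); last by rewrite exprS; ring.
  by apply: ler_wpM2l => //; exact: exprn_ge0.
Qed.

(** In the first model the independent set is completely joined to a part of mass
    d = b / v of the clique, in the second one the clique to a part of mass b / u
    of the independent set.  The mean p = q_2 / b of the bipartite degrees, taken
    over the edges at their ends in the independent set, lies between d and u and
    fixes the position on the chord; [cross_bounds] keeps r_2 below it. *)
Theorem split_graph_walks_le r c : (0 < r)%N -> 0 < c < 1 ->
  c * #|T|%:R ^+ 2 <= u ^+ 2 + 2 * b ->
  (\sum_x walks A (2 * r) x)%:R <=
    Num.sqrt ((u ^+ 2 + 2 * b) / c) ^+ (2 * r + 1) * extremal_bound r c.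
Proof.
move=> r0 c01 ce.
have uvN : u + v = #|T|%:R by rewrite /u /v -natrD cardC.
have [u0 v0] : 0 <= u /\ 0 <= v by rewrite /u /v !ler0n.
have b0 := cross_edges_ge0.
have /andP[c0 c1] := c01.
have bound0 : 0 <= extremal_bound r c by rewrite /extremal_bound le_max exprn_ge0 ?orbT ?sqrtr_ge0.
have [N0|N0] := eqVneq (#|T|%:R : R) 0.
  rewrite big1 ?mulr_ge0 ?exprn_ge0 ?sqrtr_ge0 // => x _.
  by move/eqP: N0; rewrite pnatr_eq0 => /eqP/card0_eq/(_ x).
have Npos : 0 < #|T|%:R :> R by rewrite lt_neqAle eq_sym N0 ler0n.
have buv : b <= u * v.
  rewrite /cross_edges /u /v -!sum1_card !natr_sum mulr_suml; apply: ler_sum => x _.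
  by rewrite mul1r; apply: ler_sum => y _; exact: cross_le1.
have hle : (\sum_x walks A (2 * r) x)%:R <= hs (2 * r).
  rewrite natr_sum /total; apply: ler_sum => x _.
  by rewrite mul1r; exact: walks_le_split.
apply: (le_trans hle).
have model d q w : 0 <= d -> 0 <= q -> 0 <= w -> d + q = u -> d * w = b -> w <= v ->
    jval (dom_jet d q w (2 * r + 1)) <= Num.sqrt ((u ^+ 2 + 2 * b) / c) ^+ (2 * r + 1) * extremal_bound r c.
  move=> d0 q0 w0 dq dw wv.
  have tot : d + q + w <= #|T|%:R by rewrite dq -uvN lerD2l.
  have := model_le_extremal r0 d0 q0 w0 tot Npos c01.
  by rewrite dq -mulrA dw; apply.
have [b_eq0|b_neq0] := eqVneq b 0.
  have q2 : qs 2 <= 0 by apply: (le_trans (total_side_walksSS R U symA _ _)); rewrite b_eq0 mul0r.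
  have r2 : rs 2 <= 0 by apply: (le_trans (total_side_walksSS R U symA _ _)); rewrite b_eq0 mul0r.
  have M : [/\ 0 <= u, 0 <= (0 : R), 0 <= (0 : R), u + 0 = u & u * 0 = b].
    by split; rewrite ?addr0 ?mulr0.
  have h := split_walks_le_models r0 ler01 (lexx 0) (addr0 1) M M (lexx u).
  rewrite [X in X * (1 * u + _)]b_eq0 [X in X * (1 * 0 + _)]b_eq0 !mul0r addr0 mul1r in h.
  apply: (le_trans (h q2 r2)); apply: model => //; rewrite ?addr0 ?mulr0 //.
have bpos : 0 < b by rewrite lt_neqAle eq_sym b_neq0.
have uv0 : 0 < u * v by apply: lt_le_trans buv.
have un0 : u != 0 by apply: contraTneq uv0 => ->; rewrite mul0r ltxx.
have vn0 : v != 0 by apply: contraTneq uv0 => ->; rewrite mulr0 ltxx.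
have upos : 0 < u by rewrite lt_neqAle eq_sym un0.
have vpos : 0 < v by rewrite lt_neqAle eq_sym vn0.
have [] := cross_bounds R U symA; rewrite -/u -/v => cb1 cb2.
have q2u : qs 2 <= b * u.
  by rewrite -[X in _ <= _ * X](total_clique_side0 R A U); exact: (total_side_walksSS R U symA).
pose d := b / v; pose p := qs 2 / b.
have d0 : 0 <= d by rewrite divr_ge0.
have du : d <= u by rewrite ler_pdivrMr.
have dv : d * v = b by rewrite /d divfK.
have q2E : qs 2 = b * p by rewrite /p mulrC divfK.
have dp : d <= p.
  rewrite ler_pdivrMr // -(ler_pM2l bpos) mulrA -q2E -expr2 mulrC //.
have pu : p <= u by rewrite -(ler_pM2l bpos) -q2E.
have [l [m [l0 m0 lm pE]]] : exists l m : R, [/\ 0 <= l, 0 <= m, l + m = 1 & p = l * d + m * u].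
  have [E|E] := eqVneq d u.
    exists 1, 0; split; rewrite ?addr0 ?mul0r ?addr0 ?mul1r //.
    by apply/eqP; rewrite eq_le dp E pu.
  have D : 0 < u - d by rewrite subr_gt0 lt_neqAle E.
  exists ((u - p) / (u - d)), ((p - d) / (u - d)).
  have Dn0 : u - d != 0 by rewrite gt_eqF.
  split; [by rewrite divr_ge0 ?subr_ge0 // ltW|by rewrite divr_ge0 ?subr_ge0 // ltW| |].
    by field.
  by field.
have MB : [/\ 0 <= d, 0 <= u - d, 0 <= v, d + (u - d) = u & d * v = b].
  by split; rewrite ?subr_ge0 // addrC subrK.
have MA : [/\ 0 <= u, 0 <= (0 : R), 0 <= b / u, u + 0 = u & u * (b / u) = b].
  by split; rewrite ?addr0 ?divr_ge0 // mulrC divfK.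
have r2 : rs 2 <= b * (l * v + m * (b / u)).
  rewrite -(ler_pM2l upos); move: cb1; rewrite q2E pE => cb1.
  rewrite [leRHS](_ : _ = b * (u * v + b) - v * (b * (l * d + m * u))); first lra.
  have -> : v * (b * (l * d + m * u)) = b * (l * b + m * (u * v)) by rewrite -dv; ring.
  rewrite [LHS](_ : _ = b * (l * (u * v) + m * b)); last by field.
  by rewrite (_ : l = 1 - m); [ring|lra].
have q2 : qs 2 <= b * (l * d + m * u) by rewrite q2E pE.
apply: (le_trans (split_walks_le_models r0 l0 m0 lm MB MA du q2 r2)).
have hB : jval (dom_jet d (u - d) v (2 * r + 1)) <=
    Num.sqrt ((u ^+ 2 + 2 * b) / c) ^+ (2 * r + 1) * extremal_bound r c.
  by have [? ? ? ? ?] := MB; apply: model.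
have hA : jval (dom_jet u 0 (b / u) (2 * r + 1)) <=
    Num.sqrt ((u ^+ 2 + 2 * b) / c) ^+ (2 * r + 1) * extremal_bound r c.
  have [? ? ? ? ?] := MA; apply: model => //.
  by rewrite ler_pdivrMr // mulrC.
move: hA hB; set Z := _ ^+ _ * extremal_bound r c => hA hB.
have -> : Z = l * Z + m * Z by rewrite -mulrDl lm mul1r.
by apply: lerD; apply: ler_wpM2l.
Qed.

End split_graph_bound.

(** * The number of walks in a graph *)

Section upper_bound.
Variable R : realType.

Lemma sum_deg_split (T : finType) (A : rel T) (U : {set T}) :
  symmetric A -> irreflexive A ->
  (forall x y, x \in U -> y \in U -> x != y -> A x y) ->
  (forall x y, x \notin U -> y \notin U -> ~~ A x y) ->
  (\sum_x deg A x)%:R + #|U|%:R = #|U|%:R ^+ 2 + 2 * cross_edges R A U.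
Proof.
move=> symA irrA cliqueU indepU.
have E1 : cross_edges R A U = \sum_x \sum_(y in U) cross R A U x y.
  rewrite -(cross_edges_side R U symA true); apply: eq_bigr => x _.
  rewrite [RHS]big_mkcond; apply: eq_bigr => y _.
  by rewrite /side; case: (y \in U); rewrite ?mulr0 ?mulr1.
have E2 : cross_edges R A U = \sum_x \sum_(y | y \notin U) cross R A U x y.
  rewrite -(cross_edges_side R U symA false); apply: eq_bigr => x _.
  rewrite [RHS]big_mkcond; apply: eq_bigr => y _.
  by rewrite /side; case: (y \in U); rewrite ?mulr0 ?mulr1.
have E3 : 2 * cross_edges R A U = \sum_x \sum_y cross R A U x y.
  rewrite mulrDl mul1r {1}E1 E2 -big_split; apply: eq_bigr => x _.
  by rewrite [RHS](bigID (mem U)).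
have EU : #|U|%:R = \sum_x (x \in U)%:R :> R.
  by rewrite -sum1_card natr_sum big_mkcond; apply: eq_bigr => x _; case: (x \in U).
rewrite E3 {1}EU natr_sum -big_split /=.
have -> : #|U|%:R ^+ 2 = \sum_x \sum_y ((x \in U) && (y \in U))%:R :> R.
  rewrite expr2 -sum1_card natr_sum mulr_suml [LHS]big_mkcond; apply: eq_bigr => x _.
  case: (x \in U); last by rewrite /= big1.
  by rewrite mul1r [LHS]big_mkcond; apply: eq_bigr => y _; case: (y \in U).
rewrite -big_split; apply: eq_bigr => x _ /=.
rewrite -big_split /= /deg natr_sum.
have -> : (x \in U)%:R = \sum_y ((x \in U) && (y == x))%:R :> R.
  case: (x \in U); last by rewrite big1.
  by rewrite (bigD1 x) //= eqxx big1 ?addr0 // => y /negbTE ->.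
rewrite -big_split; apply: eq_bigr => y _ /=.
rewrite /cross; have [->|yx] := eqVneq y x.
  by rewrite irrA andbb andbT /= addr0 add0r.
have [xU|xU] := boolP (x \in U); have [yU|yU] := boolP (y \in U);
  rewrite /= ?andbF ?andbT ?addr0 ?add0r //.
  by rewrite cliqueU // eq_sym.
by rewrite (negbTE (indepU _ _ xU yU)).
Qed.

Lemma exp1D_le (y : R) k : 0 <= y <= 1 -> (1 + y) ^+ k <= 1 + 2 ^+ k * y.
Proof.
move=> /andP[y0 y1].
have H : (1 + y) ^+ k <= 1 + (2 ^+ k - 1) * y.
  elim: k => [|k IH]; first by rewrite !expr0 subrr mul0r addr0.
  rewrite exprSr; apply: (le_trans (ler_wpM2r _ IH)); first by rewrite addr_ge0.
  have p : 1 <= 2 ^+ k :> R by rewrite exprn_ege1//; lra.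
  rewrite exprS -subr_ge0 (_ : _ - _ = (2 ^+ k - 1) * y * (1 - y)); last by ring.
  by rewrite !mulr_ge0 ?subr_ge0.
by apply: (le_trans H); rewrite lerD2l ler_wpM2r // gerBl.
Qed.

(** The loops raise the edge mass from e to e + |U|.  The bound is homogeneous of
    degree r + 1/2 in the edge mass, so this costs a factor 1 + O(|U| / e), hence
    O(n^(2r)) in total, because the bound is at most c n^(2r+1). *)
Theorem walks_le_extremal (T : finType) (A : rel T) m r (c : R) : (0 < r)%N ->
  symmetric A -> irreflexive A -> 0 < c < 1 ->
  (\sum_x deg A x = 2 * m)%N -> (2 * m)%:R = c * #|T|%:R ^+ 2 ->
  (\sum_x walks A (2 * r) x)%:R <=
    extremal_bound r c * #|T|%:R ^+ (2 * r + 1) + 2 ^+ (2 * r + 1) * #|T|%:R ^+ (2 * r).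
Proof.
move=> r0 symA irrA c01 degA cE; have /andP[c0 c1] := c01.
have [B [symB irrB nestB degB walkB]] := exists_nested (2 * r) symA irrA.
have [U [cliqueU indepU]] := nested_split symB irrB nestB.
have eE := sum_deg_split symB irrB cliqueU indepU.
set b := cross_edges R B U in eE; set u : R := #|U|%:R in eE.
rewrite degB degA cE in eE.
set N : R := #|T|%:R in eE cE *.
have b0 : 0 <= b := cross_edges_ge0 R B U.
have u0 : 0 <= u by rewrite ler0n.
have N0 : 0 <= N by rewrite ler0n.
have W : (\sum_x walks A (2 * r) x)%:R <=
    Num.sqrt ((u ^+ 2 + 2 * b) / c) ^+ (2 * r + 1) * extremal_bound r c.
  apply: (@le_trans _ _ (\sum_x walks B (2 * r) x)%:R); first by rewrite ler_nat.
  by apply: split_graph_walks_le => //; rewrite -/N -/u -/b -eE lerDl.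
apply: (le_trans W); rewrite -eE => {W}.
have bound0 : 0 <= extremal_bound r c by rewrite /extremal_bound le_max exprn_ge0 ?orbT ?sqrtr_ge0.
have [N_eq0|N_neq0] := eqVneq N 0.
  have -> : u = 0.
    by apply/eqP; rewrite eq_le u0 andbT -N_eq0 ler_nat max_card.
  rewrite N_eq0 expr0n /= mulr0 add0r mul0r sqrtr0 addn1 !expr0n /= mul0r mulr0 add0r.
  by rewrite mulr_ge0 ?exprn_ge0 ?ler0n.
have Npos : 0 < N by rewrite lt_neqAle eq_sym N_neq0.
have uN : u <= N by rewrite ler_nat max_card.
pose y := u / (c * N ^+ 2).
have e0 : 0 < c * N ^+ 2 by rewrite mulr_gt0 ?exprn_gt0.
(* The edge mass is a positive even number.  This gives |U| <= c N^2 when U has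
   at most two vertices. *)
have e2 : 2 <= c * N ^+ 2.
  rewrite -cE natrM ler_peMr // ler1n lt0n; apply: contraTneq e0 => m0.
  by rewrite -cE m0 muln0 ltxx.
have ue : u <= c * N ^+ 2.
  have [u2|u2] := leP u 2; first exact: le_trans e2.
  by nra.
have y01 : 0 <= y <= 1 by rewrite divr_ge0 ?(ltW e0) //= ler_pdivrMr ?mul1r.
have -> : (c * N ^+ 2 + u) / c = N ^+ 2 * (1 + y).
  by rewrite /y; field; rewrite N_neq0 gt_eqF.
rewrite sqrtrM ?sqr_ge0 // sqrtr_sqr ger0_norm // exprMn.
have /andP[y0 y1] := y01.
have s1 : Num.sqrt (1 + y) ^+ (2 * r + 1) <= 1 + 2 ^+ (2 * r + 1) * y.
  apply: le_trans (exp1D_le _ y01); apply: lerXn2r; rewrite ?nnegrE ?sqrtr_ge0 //; first lra.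
  rewrite -(@ler_pXn2r _ 2) ?nnegrE ?sqrtr_ge0 ?sqr_sqrtr //; nra.
have cy : N * (extremal_bound r c * y) <= 1.
  have : extremal_bound r c * y <= c * y by apply: ler_wpM2r => //; exact: extremal_bound_le.
  have -> : c * y = u / N ^+ 2 by rewrite /y; field; rewrite N_neq0 gt_eqF.
  move=> h; apply: (le_trans (ler_wpM2l N0 h)).
  rewrite (_ : N * (u / N ^+ 2) = u / N); last by field.
  by rewrite ler_pdivrMr ?mul1r.
rewrite mulrAC -mulrA.
apply: (le_trans (ler_wpM2l _ (ler_wpM2l bound0 s1))); first exact: exprn_ge0.
rewrite mulrDr mulr1 mulrDr [leLHS]addrC [leRHS]addrC [extremal_bound r c * _]mulrC lerD2r.
rewrite addn1 [N ^+ _.+1]exprSr.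
rewrite [leLHS](_ : _ = 2 ^+ (2 * r).+1 * N ^+ (2 * r) * (N * (extremal_bound r c * y))); last by ring.
by rewrite ler_piMr // mulr_ge0 ?exprn_ge0.
Qed.

End upper_bound.

(** * Path densities of the quasi-star and quasi-clique graphons *)

Section step_integrals.
Local Open Scope classical_set_scope.
Local Open Scope ring_scope.
Variable R : realType.

Definition step (g A B : R) (t : R) : R := if t < g then A else B.

Lemma Rintegral_step g A B : 0 <= g <= 1 ->
  \int[lebesgue_measure]_(t in `[0, 1]) step g A B t = g * A + (1 - g) * B.
Proof.
move=> /andP[g0 g1].
have mstep : measurable_fun setT (step g A B).
  apply: measurable_fun_ifT => //; exact: measurable_fun_ltr.
have split01 : `[0, 1]%classic = `[0, g[%classic `|` `[g, 1]%classic :> set R.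
  by rewrite -itv_bndbnd_setU // bnd_simp.
rewrite split01 Rintegral_setU //; last first.
- apply/disj_setPS => x [] /=; rewrite !in_itv /= => /andP[_ xg] /andP[gx _].
  by move: (lt_le_trans xg gx); rewrite ltxx.
- rewrite -split01; apply: measurable_bounded_integrable => //.
  + by rewrite /= lebesgue_measure_itv /=; case: ifP => _; rewrite ?ltry.
  + exact: measurable_funTS.
  + exists (`|A| + `|B|); split; first exact: num_real.
    move=> M hM x _ /=; rewrite /step; have := normr_ge0 A; have := normr_ge0 B.
    by case: ifP; lra.
have -> : \int[lebesgue_measure]_(t in `[0, g[) step g A B t =
    \int[lebesgue_measure]_(t in `[0, g[) A.
  by apply: eq_Rintegral => x; rewrite inE /= in_itv /= => /andP[_ xg]; rewrite /step xg.
have -> : \int[lebesgue_measure]_(t in `[g, 1]) step g A B t =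
    \int[lebesgue_measure]_(t in `[g, 1]) B.
  by apply: eq_Rintegral => x; rewrite inE /= in_itv /= => /andP[gx _]; rewrite /step ltNge gx.
rewrite !Rintegral_cst //= !lebesgue_measure_itv /= !lte_fin.
have [g_gt0|g_le0] := ltP 0 g; have [g_lt1|g_ge1] := ltP g 1; rewrite /=.
- by rewrite subr0; ring.
- have gE : g = 1 by lra.
  rewrite gE; ring.
- have gE : g = 0 by lra.
  rewrite gE; ring.
- by lra.
Qed.

End step_integrals.

Section path_density.
Local Open Scope classical_set_scope.
Local Open Scope ring_scope.
Variables (R : realType) (k : nat).
Notation H := (path_graph k.+1).

Lemma enum_path_graph : enum H = [seq inord i | i <- iota 0 k.+1] :> seq 'I_k.+1.
Proof.
rewrite -val_enum_ord -map_comp -[LHS]map_id.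
by apply: eq_map => i /=; rewrite inord_val.
Qed.

Lemma prod_path_graph (F : 'I_k.+1 -> 'I_k.+1 -> R) :
  \prod_(p : H * H | adj p.1 p.2 && (enum_rank p.1 < enum_rank p.2)%N) F p.1 p.2
  = \prod_(j < k) F (inord j) (inord j.+1).
Proof.
transitivity (\prod_(u : 'I_k.+1) \prod_(v : 'I_k.+1 | (u.+1 == v)%N) F u v).
  rewrite pair_big_dep /=; apply: eq_bigl => -[u v] /=.
  rewrite /path_adj !enum_rank_ord /=.
  by apply/idP/idP; lia.
rewrite big_ord_recr /= [X in _ * X]big_pred0 ?mulr1; last first.
  by move=> v /=; have := ltn_ord v; lia.
apply: eq_bigr => j _; rewrite (big_pred1 (inord j.+1)).
  by congr (F _ _); apply/val_inj; rewrite /= inordK // ltnS ltnW.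
by move=> v /=; rewrite -val_eqE /= inordK ?ltnS // eq_sym.
Qed.

Variables (W : R -> R -> R) (g : R) (w1 w2 : R -> R) (a b : nat -> R).
Hypothesis g01 : 0 <= g <= 1.
Hypothesis WE : forall x t, W x t = step g (w1 x) (w2 x) t.
Hypotheses (a0 : a 0 = 1) (b0 : b 0 = 1).
Hypothesis JE : forall m x, step g (a m.+1) (b m.+1) x =
  g * (w1 x * a m) + (1 - g) * (w2 x * b m).
Let J m x := step g (a m) (b m) x.

Lemma J_int m x C : \int[lebesgue_measure]_(t in `[0, 1]) (C * (W x t * J m t)) = C * J m.+1 x.
Proof.
rewrite /J JE; transitivity (\int[lebesgue_measure]_(t in `[0, 1])
   step g (C * (w1 x * a m)) (C * (w2 x * b m)) t).
  by apply: eq_Rintegral => t _; rewrite WE /step; case: ifP.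
by rewrite Rintegral_step //; ring.
Qed.

(** Integrating out the last vertices one by one leaves a step function of the
    last remaining vertex. *)
Lemma cube_integral_path m i (x : 'I_k.+1 -> R) : (i.+1 + m = k.+1)%N ->
  cube_integral [seq inord j : 'I_k.+1 | j <- iota i.+1 m]
    (fun x => \prod_(j < k) W (x (inord j)) (x (inord j.+1))) x =
  (\prod_(j < i) W (x (inord j)) (x (inord j.+1))) * J m (x (inord i)).
Proof.
elim: m i x => [|m IH] i x im /=.
  by rewrite /J /step a0 b0 (_ : i = k) ?if_same ?mulr1//; lia.
rewrite -J_int; apply: eq_Rintegral => t _.
rewrite IH; last by lia.
have ne j : (j <= i)%N -> (inord j == inord i.+1 :> 'I_k.+1) = false.
  by move=> ji; rewrite -val_eqE /= !inordK; lia.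
rewrite big_ord_recr /= eqxx ne // -mulrA; congr (_ * _).
apply: eq_bigr => j _.
by rewrite !ne //; have := ltn_ord j; lia.
Qed.

Lemma hom_density_path (Wg : graphon R) : graphon_fun Wg = W ->
  hom_density H Wg = g * a k + (1 - g) * b k.
Proof.
move=> WgE; rewrite /hom_density WgE enum_path_graph.
have -> : (fun x : H -> R => \prod_(p : H * H | adj p.1 p.2 && (enum_rank p.1 < enum_rank p.2)%N)
     W (x p.1) (x p.2)) = (fun x => \prod_(j < k) W (x (inord j)) (x (inord j.+1))).
  by apply/funext => x; rewrite (prod_path_graph (fun u v => W (x u) (x v))).
rewrite /= -Rintegral_step //; apply: eq_Rintegral => t _.
rewrite cube_integral_path; last by rewrite add1n.
by rewrite big_ord0 mul1r /= eqxx.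
Qed.

End path_density.

Section extremal_densities.
Variables (R : realType) (r : nat) (c : R).
Hypotheses (r0 : (0 < r)%N) (c01 : 0 < c < 1).

Lemma hom_density_star : hom_density (path_graph (2 * r + 1)) (quasi_star c) = S_val r c.
Proof.
have [a_gt0 a_lt1 cE] := sqrt_param c01.
set a := Num.sqrt (1 - c) in a_gt0 a_lt1 cE.
pose X := star (1 - a) a.
have XS m : X m.+2 = (1 - a) * X m.+1 + (1 - a) * a * X m by exact: starSS.
have X01 : X 0 = 1 /\ X 1 = 1 by rewrite /X star0 star1 subrK.
rewrite addn1.
rewrite (@hom_density_path _ _ (quasi_star_fun c) (1 - a) (fun=> 1) (fun x => (x < 1 - a)%R%:R) X
   (fun m => if m is m'.+1 then (1 - a) * X m' else 1)) //.
- rewrite S_val_star -/a -/X addn1.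
  case: (2 * r)%N => [|k]; last by rewrite XS; ring.
  by have [-> ->] := X01; ring.
- by apply/andP; split; lra.
- by move=> x t; rewrite /quasi_star_fun /step -/a gt_min; case: (x < _); case: (t < _).
- move=> m x; rewrite /step; case: (x < 1 - a); last by rewrite /=; ring.
  case: m => [|m] /=; last by rewrite XS; ring.
  by have [-> ->] := X01; ring.
Qed.

Lemma hom_density_clique :
  hom_density (path_graph (2 * r + 1)) (quasi_clique c) = Num.sqrt c ^+ (2 * r + 1).
Proof.
have /andP[c0 c1] := c01; pose g := Num.sqrt c.
have g0 : 0 <= g by exact: sqrtr_ge0.
have g1 : g <= 1 by rewrite -(sqrtr1 R) ler_wsqrtr // ltW.
rewrite addn1.
rewrite (@hom_density_path _ _ (quasi_clique_fun c) g (fun x => (x < g)%R%:R) (fun=> 0)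
   (fun m => g ^+ m) (fun m => (m == 0)%:R)) //.
- rewrite (_ : (2 * r == 0)%N = false); last by clear -r0; lia.
  by rewrite mulr0 addr0 exprS.
- by rewrite g0.
- by move=> x t; rewrite /quasi_clique_fun /step -/g gt_max; case: (x < _); case: (t < _).
- by move=> m x; rewrite /step; case: (x < g); rewrite /= ?exprS; ring.
Qed.

End extremal_densities.

(** * The number of paths *)

Section first_order.
Local Open Scope classical_set_scope.
Local Open Scope ring_scope.
Variables (R : realType) (r : nat).
Hypothesis r0 : (0 < r)%N.
Notation k := (2 * r + 1)%N.

Lemma path_count_bound (G : sgraph) (c : R) : c = edge_density R G -> 0 < c < 1 ->
  (subgraph_count (path_graph k) G)%:R <=
    1 / 2 * extremal_bound r c * #|G|%:R ^+ k + 2 ^+ (2 * r) * #|G|%:R ^+ (2 * r).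
Proof.
move=> cE c01; have /andP[c0 _] := c01.
have N0 : #|G|%:R != 0 :> R.
  apply/eqP => N0; move: c0.
  by rewrite cE /edge_density N0 expr0n /= invr0 mulr0 ltxx.
have degG : (\sum_x deg (@adj G) x = 2 * #|edges G|)%N by rewrite handshake.
have eE : (2 * #|edges G|)%:R = c * #|G|%:R ^+ 2.
  by rewrite cE /edge_density natrM divfK // expf_neq0.
have W := walks_le_extremal r0 (@adj_sym G) (@adj_irrefl G) c01 degG eE.
rewrite -hom_count_path in W.
have kE : k = (2 * r - 1).+2 by clear -r0; lia.
have P := subgraph_count_path_le G (2 * r - 1); rewrite -kE in P.
have P' : 2 * (subgraph_count (path_graph k) G)%:R <= (hom_count (path_graph k) G)%:R :> R.
  by rewrite -natrM ler_nat.
rewrite -addn1 in W.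
have := le_trans P' W; rewrite [2 ^+ k]exprD expr1.
by move: (_ ^+ (2 * r)) (_ ^+ (2 * r)) (_ ^+ k) => x y z; nra.
Qed.

(** Twice the number of copies and the number of homomorphisms differ by the
    O(n^(2r)) maps that are not injective. *)
Lemma first_order_of_density (G : nat -> sgraph) (W : graphon R) (v : R) :
  (forall n, #|G n| = n) -> converges_to G W -> hom_density (path_graph k) W = 2 * v ->
  (fun n : nat => (subgraph_count (path_graph k) (G n))%:R - v * n%:R ^+ k : R^o)
      =o_\oo (fun n : nat => n%:R ^+ k : R^o).
Proof.
move=> cardG cvgG dW.
have kE : k = (2 * r - 1).+2 by clear -r0; lia.
have k1E : (2 * r - 1).+1 = (2 * r)%N by clear -r0; lia.
pose K : R := (k ^ 2)%:R.
have K0 : 0 <= K by exact: ler0n.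
have err n : `|2 * (subgraph_count (path_graph k) (G n))%:R
    - (hom_count (path_graph k) (G n))%:R| <= K * n%:R ^+ (2 * r) :> R.
  have P := subgraph_count_path_le (G n) (2 * r - 1).
  have Q := subgraph_count_path_ge (G n) (2 * r - 1).
  rewrite cardG -kE k1E in P Q.
  rewrite -(ler_nat R) natrM in P; rewrite -(ler_nat R) natrD !natrM -/K natrX in Q.
  by rewrite distrC ger0_norm ?subr_ge0 // lerBlDl /K natrX expr2.
apply/eqoP => e e0.
have cvgH := cvgG (path_graph k); rewrite dW in cvgH.
have cardH : #|path_graph k| = k by rewrite card_ord.
rewrite cardH in cvgH.
have e2 : 0 < e / 2 by rewrite divr_gt0.
have /cvgrPdist_le/(_ _ e0) near1 := cvgH.
near=> n.
have n0 : (0 : R) < n%:R by near: n; exact: nbhs_infty_gtr.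
have nK : K / e <= n%:R by near: n; exact: nbhs_infty_ger.
have close : `|2 * v - (hom_count (path_graph k) (G n))%:R / n%:R ^+ k| <= e.
  by near: n.
have nk0 : 0 < n%:R ^+ k :> R by exact: exprn_gt0.
rewrite [X in _ <= _ * X]ger0_norm ?(ltW nk0) //.
have E1 : `|(hom_count (path_graph k) (G n))%:R - 2 * v * n%:R ^+ k| <= e * n%:R ^+ k.
  rewrite distrC -[X in _ <= _ * X]ger0_norm ?(ltW nk0) // -[X in `|_ - X|](divfK (lt0r_neq0 nk0)).
  by rewrite -mulrBl normrM ler_wpM2r.
have E2 : K * n%:R ^+ (2 * r) <= e * n%:R ^+ k.
  rewrite addn1 exprS mulrA ler_wpM2r ?exprn_ge0 ?ler0n //.
  by rewrite mulrC -ler_pdivrMr.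
have E3 := err n.
change (`|(subgraph_count (path_graph k) (G n))%:R - v * n%:R ^+ k : R| <= e * n%:R ^+ k).
move: E1 E3 E2; rewrite !ler_norml.
by move=> /andP[? ?] /andP[? ?] ?; apply/andP; split; lra.
Unshelve. all: by end_near.
Qed.

End first_order.

Local Open Scope classical_set_scope.
Local Open Scope ring_scope.

Theorem theorem1p1 (R : realType) (r : nat) (hr : (1 <= r)%N) :
  let k := (2 * r + 1)%N in
  let cr : R := c_val R r in
  let star_value (c : R) : R := 1 / 2 * S_val r c in
  let clique_value (c : R) : R := 1 / 2 * c `^ (r%:R + 1 / 2) in
  let first_order (G : nat -> sgraph) (v : R) :=
    (fun n : nat => (subgraph_count (path_graph k) (G n))%:R - v * n%:R ^+ k : R^o)
      =o_\oo (fun n : nat => n%:R ^+ k : R^o) in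
  let star_attains (c : R) :=
    forall G : nat -> sgraph, (forall n, #|G n| = n) ->
      converges_to G (quasi_star c) -> first_order G (star_value c) in
  let clique_attains (c : R) :=
    forall G : nat -> sgraph, (forall n, #|G n| = n) ->
      converges_to G (quasi_clique c) -> first_order G (clique_value c) in
  [/\ exists K : R, forall (n : nat) (G : sgraph) (c : R),
        #|G| = n -> c = edge_density R G -> 0 < c < 1 ->
        (c <= cr ->
          (subgraph_count (path_graph k) G)%:R
            <= star_value c * n%:R ^+ k + K * n%:R ^+ (2 * r)) /\
        (cr <= c ->
          (subgraph_count (path_graph k) G)%:R
            <= clique_value c * n%:R ^+ k + K * n%:R ^+ (2 * r)),
      forall c : R, 0 < c < cr -> star_attains c,
      forall c : R, cr < c < 1 -> clique_attains c
    & [/\ star_attains cr, clique_attains cr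
        & star_value cr = clique_value cr] ].
Proof.
move=> k cr star_value clique_value first_order star_attains clique_attains.
have cr01 : 0 < cr < 1 by exact: c_val_itv.
have star_all (c : R) : 0 < c < 1 -> star_attains c.
  move=> c01 G cardG cvgG; apply: (first_order_of_density hr cardG cvgG).
  by rewrite hom_density_star // /star_value; field.
have clique_all (c : R) : 0 < c < 1 -> clique_attains c.
  move=> c01 G cardG cvgG; apply: (first_order_of_density hr cardG cvgG).
  have /andP[c0 _] := c01.
  by rewrite hom_density_clique // /clique_value powR_half_odd ?ltW //; field.
have /andP[cr0 cr1] := cr01.
split.
- exists (2 ^+ (2 * r)) => n G c <- cE c01; have /andP[c0 c1] := c01.
  have B := path_count_bound hr cE c01; split=> ccr.
    by move: B; rewrite extremal_bound_star.
  by move: B; rewrite extremal_bound_clique // /clique_value powR_half_odd // ltW.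
- by move=> c /andP[c0 ccr]; apply: star_all; rewrite c0 (lt_trans ccr).
- by move=> c /andP[crc c1]; apply: clique_all; rewrite c1 (lt_trans cr0).
- split; [exact: star_all|exact: clique_all|].
  rewrite /star_value /clique_value powR_half_odd ?ltW //; congr (_ * _).
  by rewrite -extremal_bound_star // extremal_bound_clique.
Qed.
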